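(* Let $L u = a_{ij}(x)u_{ij} + b_i(x)u_i$ be an operator on $\overline{B}_1\subset\mathbb{R}^n$ with smooth coefficients, with $A=(a_{ij})$ symmetric and $0<\lambda \le A(x)\le \Lambda$ in $B_1$. Let $u\in C^\infty(\overline{B}_1)$ be superharmonic in the sense that $Lu\le0$ in $B_1$. Assume that $$A(0)=I\quad\text{and}\quad\|DA\|_{C^0(\overline{B}_1)}+\|b\|_{C^0(\overline{B}_1)}\le\varepsilon$$ for some $\varepsilon>0$. Then there exists a constant $t$, which depends on $u$, such that $$\|u-t\|_{L^1(B_1\setminus B_{1/8})}\le C\|u_r\|_{L^1(B_1\setminus B_{1/8})}+C\varepsilon\|\nabla u\|_{L^1(B_1)},$$ where $C$ is a constant depending only on $n$ and $\lambda$.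
   Context: $B_r$ is the open ball of radius $r$ centered at $0$ in $\mathbb{R}^n$; $I$ is the identity matrix; $u_r=\frac{x}{|x|}\cdot\nabla u$ is the radial derivative. Repeated indices are summed; $u_i=\partial_i u$, $u_{ij}=\partial_{ij}u$. The operator is $Lu=a_{ij}(x)u_{ij}+b_i(x)u_i$ with $a_{ij}=a_{ji}$, $A(x)=(a_{ij}(x))$, $b=(b_i)$, the coefficients being smooth on $\overline{B}_1$. Uniform ellipticity $\lambda\le A(x)\le\Lambda$ means $0<\lambda\le a_{ij}(x)p_ip_j\le\Lambda$ for all $x\in B_1$ and all $p\in\mathbb{R}^n$ with $|p|=1$. *)

(* Defs.v *)
From HB Require Import structures.
From mathcomp Require Import all_boot all_order all_algebra.
From mathcomp Require Import all_classical all_reals all_analysis.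

Set Implicit Arguments.
Unset Strict Implicit.
Unset Printing Implicit Defensive.

Import Order.TTheory GRing.Theory Num.Theory.
Import numFieldNormedType.Exports.

Local Open Scope classical_set_scope.
Local Open Scope ring_scope.

Section LebesgueRn.
Context {R : realType}.
Local Notation Rb := (measurableTypeR R).

Definition cons_pair n (p : Rb * n.-tuple Rb) : n.+1.-tuple Rb :=
  [tuple of p.1 :: p.2].

(* Lebesgue measure on R^n: the n-fold product of the one-dimensional one. *)
Fixpoint lebesgue_Rn (n : nat) : set (n.-tuple Rb) -> \bar R :=
  match n with
  | 0 => dirac [tuple]
  | m.+1 => pushforward (product_measure1 lebesgue_measure (@lebesgue_Rn m))
                        (@cons_pair m)
  end.

Lemma measurable_cons_pair n : measurable_fun setT (@cons_pair n).
Proof. exact: measurable_cons. Qed.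

Lemma sigma_finite_pushforward_cons n
    (nu : {sigma_finite_measure set (n.-tuple Rb) -> \bar R}) :
  sigma_finite setT (pushforward (product_measure1 lebesgue_measure nu)
                                 (@cons_pair n)).
Proof.
have [F TF Ffin] : sigma_finite setT (product_measure1 (@lebesgue_measure R) nu).
  have /sigma_finiteP[F [TF ndF Foo]] := sigma_finiteT (@lebesgue_measure R).
  have /sigma_finiteP[G [TG ndG Goo]] := sigma_finiteT nu.
  exists (fun k => F k `*` G k).
    rewrite -setXTT TF TG; apply/seteqP; split => -[x y] /=; last first.
      by move=> [k _ []/= ? ?]; split; exists k.
    move=> [/= [k _ Fkx] [l _ Gly]]; exists (maxn k l) => //; split.
      by move: x Fkx; exact/subsetPset/ndF/leq_maxl.
    by move: y Gly; exact/subsetPset/ndG/leq_maxr.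
  move=> k; have [? ?] := Foo k; have [? ?] := Goo k.
  split; first exact: measurableX.
  by rewrite product_measure1E// lte_mul_pinfty// ge0_fin_numE.
pose g (t : n.+1.-tuple Rb) : Rb * n.-tuple Rb :=
  (tnth t ord0, [tuple of behead t]).
have gK p : g (cons_pair p) = p.
  by case: p => x t; rewrite /g /cons_pair/=; congr pair; exact/val_inj.
have mg : measurable_fun setT g.
  apply/measurable_fun_pairP; split; first exact: measurable_tnth.
  exact: measurable_behead.
exists (fun i => g @^-1` F i).
  by rewrite -preimage_bigcup -TF preimage_setT.
move=> i; have [mF Foo] := Ffin i; split.
  by rewrite -[X in measurable X]setTI; exact: mg.
rewrite /pushforward (_ : _ @^-1` _ = F i)//.
by apply/seteqP; split => p /=; rewrite gK.
Qed.

Section step.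
Variables (n : nat) (nu : {sigma_finite_measure set (n.-tuple Rb) -> \bar R}).

Definition lebesgue_step : set (n.+1.-tuple Rb) -> \bar R :=
  pushforward (product_measure1 lebesgue_measure nu) (@cons_pair n).

Let pushforward_measure : {measure set (n.+1.-tuple Rb) -> \bar R}.
Proof.
pose lnu : {measure set (Rb * n.-tuple Rb)%type -> \bar R} :=
  (lebesgue_measure \x nu)%E.
unshelve refine (pushforward lnu (@cons_pair n) :
  {measure set (n.+1.-tuple Rb) -> \bar R}).
exact: measurable_cons_pair.
Defined.

HB.instance Definition _ := isMeasure.Build _ _ _ lebesgue_step
  (measure0 pushforward_measure) (measure_ge0 pushforward_measure)
  (@measure_semi_sigma_additive _ _ _ pushforward_measure).

HB.instance Definition _ := Measure_isSigmaFinite.Build _ _ _ lebesgue_step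
  (sigma_finite_pushforward_cons nu).

Lemma lebesgue_Rn_step :
  exists mu : {sigma_finite_measure set (n.+1.-tuple Rb) -> \bar R},
    pushforward (product_measure1 lebesgue_measure nu) (@cons_pair n) = mu.
Proof. by exists lebesgue_step. Qed.

End step.

Lemma lebesgue_Rn_sigma_finite_measure n :
  exists nu : {sigma_finite_measure set (n.-tuple Rb) -> \bar R},
    @lebesgue_Rn n = nu.
Proof.
elim: n => [|n [nu nuE]] /=; first by exists (dirac [tuple]).
by rewrite nuE; exact: lebesgue_Rn_step.
Qed.

Section lebesgue_Rn_measure.
Variable n : nat.

Let leb0 : @lebesgue_Rn n set0 = 0%E.
Proof.
by have [nu ->] := lebesgue_Rn_sigma_finite_measure n; rewrite measure0.
Qed.

Let leb_ge0 A : (0 <= @lebesgue_Rn n A)%E.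
Proof.
by have [nu ->] := lebesgue_Rn_sigma_finite_measure n; exact: measure_ge0.
Qed.

Let leb_sigma_additive : semi_sigma_additive (@lebesgue_Rn n).
Proof.
have [nu ->] := lebesgue_Rn_sigma_finite_measure n.
exact: measure_semi_sigma_additive.
Qed.

HB.instance Definition _ := isMeasure.Build _ _ _ (@lebesgue_Rn n)
  leb0 leb_ge0 leb_sigma_additive.

Let leb_sigma_finite : sigma_finite setT (@lebesgue_Rn n).
Proof.
by have [nu ->] := lebesgue_Rn_sigma_finite_measure n; exact: sigma_finiteT.
Qed.

HB.instance Definition _ := Measure_isSigmaFinite.Build _ _ _ (@lebesgue_Rn n)
  leb_sigma_finite.

End lebesgue_Rn_measure.

End LebesgueRn.
Arguments lebesgue_Rn {R} n.

Section Euclidean.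
Context {R : realType} {n : nat}.
Implicit Types (x y : 'rV[R]_n) (r : R) (f : 'rV[R]_n -> R).

(* The library norm on 'rV[R]_n is the sup norm, hence this separate norm. *)
Definition enorm x : R := Num.sqrt (\sum_i x 0 i ^+ 2).

Definition eball r : set 'rV[R]_n := [set x | enorm x < r].

Definition eclosed_ball r : set 'rV[R]_n := [set x | enorm x <= r].

Definition partial (i : 'I_n) f : 'rV[R]_n -> R :=
  fun x => 'D_(delta_mx 0 i) f x.

Definition iter_partial (s : seq 'I_n) f : 'rV[R]_n -> R := foldr partial f s.

Definition grad f x : 'rV[R]_n := \row_i partial i f x.

Definition radial_derivative f x : R :=
  \sum_i x 0 i / enorm x * partial i f x.

(* C^oo of the closed unit ball: f is smooth inside, continuous up to the
   boundary, and all its derivatives extend continuously to the closed ball.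
   The functions are total on 'rV[R]_n, but only their values on the closed
   ball matter. *)
Definition smooth_closed_ball f : Prop :=
  {within eclosed_ball 1, continuous f} /\
  forall s : seq 'I_n,
    (forall x, eball 1 x -> differentiable (iter_partial s f) x) /\
    exists2 g : 'rV[R]_n -> R,
      {within eclosed_ball 1, continuous g} &
      forall x, eball 1 x -> g x = iter_partial s f x.

(* The value at x of the continuous extension of f from the open unit ball to
   the closed one.  On the unit sphere the library derivative of a function
   that is only prescribed on the closed ball carries no information. *)
Definition closure_ext f x : R := lim (f y @[y --> within (eball 1) (nbhs x)]).

Definition C0_norm (g : 'rV[R]_n -> R) : \bar R :=
  ereal_sup [set `|g x|%:E | x in eclosed_ball 1].

(* Euclidean (Frobenius) norm of the tensor of first derivatives of A. *)
Definition deriv_mx_norm (A : 'rV[R]_n -> 'M[R]_n) x : R :=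
  Num.sqrt (\sum_i \sum_j \sum_k
    closure_ext (partial k (fun y => A y i j)) x ^+ 2).

Definition operator (A : 'rV[R]_n -> 'M[R]_n) (b : 'rV[R]_n -> 'rV[R]_n)
    f x : R :=
  \sum_i \sum_j A x i j * partial i (partial j f) x
  + \sum_i b x 0 i * partial i f x.

Definition vec_of_tuple (t : n.-tuple (measurableTypeR R)) : 'rV[R]_n :=
  \row_i tnth t i.

(* The integral lives on tuples, which carry the product sigma-algebra in the
   library, while calculus lives on row vectors. *)
Definition L1_norm (D : set 'rV[R]_n) f : \bar R :=
  (\int[lebesgue_Rn n]_(t in vec_of_tuple @^-1` D) `|f (vec_of_tuple t)|%:E)%E.

End Euclidean.

(* Main.v *)
Require Import Defs.
From HB Require Import structures.
From mathcomp Require Import all_boot all_order all_algebra.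
From mathcomp Require Import all_classical all_reals all_analysis.
From mathcomp Require Import measurable_realfun ring lra.

Set Implicit Arguments.
Unset Strict Implicit.
Unset Printing Implicit Defensive.

Import Order.TTheory GRing.Theory Num.Theory.
Import numFieldNormedType.Exports.

Local Open Scope classical_set_scope.
Local Open Scope ring_scope.

(** Why the estimate holds.  Write [H] for a nonnegative density that dominates
the Laplacian of [u] in the weak sense.  Three observations suffice.

- Mass.  Moving the coefficients of [L] next to the identity costs terms of
  size [eps |grad u|] after one integration by parts, because [A 0 = I] and both
  the derivatives of [A] and [b] are at most [eps].  Testing [- L u >= 0] with
  a radial cut-off whose gradient lives in the annulus sees only the radial
  derivative of [u], so the total mass of [- L u] in a smaller ball is at most
  a constant times the right-hand side (lemma [mass_bound]).  The same
  integration by parts shows that every test function [zeta] satisfies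
  [|int grad zeta . grad u| <= K int H] with [K] a bound for [zeta] and its
  gradient (lemma [dual_bound]).

- Mollification.  Let [m] be a radial kernel supported in the shell
  [3/8 <= |z| <= 5/8], [c] its integral, and [U x] the integral of
  [m z * u (x + z)].  Since [- z m z] is the gradient of a radial potential, the
  derivative in [s] of the integral of [m z * u (x + s z)] is the gradient of [u]
  paired with the gradient of a test function, and [U - c u] is controlled in [L^1] by the mass of [H]
  ([mollify_near]).  No singular kernel occurs: the scale [s] goes down to zero
  with bounds that do not depend on it.

- Oscillation.  For [|x| <= 1/4] and [|y - x|] in the shell, [y] stays in the
  annulus.  Writing [x = y - (y - x)] turns [x . grad U x] into a radial
  derivative of [u] integrated against [m] plus a gradient of [u] integrated
  against the gradient of the potential; the sum vanishes at [x = 0], and both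
  terms are Lipschitz in [x] with a controlled constant.  Hence [U] differs
  from [U 0] by a controlled amount ([shift_bound], [mollify_osc]).

Thus [t = U 0 / c] works on the ball of radius [1/4], and comparing [u x] with
[u (x / 2)] along rays propagates the bound to the rings up to the unit sphere
([dyadic_step]). *)

(** * Borel functions of a vector *)

Section BorelRn.
Context {R : realType} {n : nat}.
Local Notation Rb := (measurableTypeR R).
Implicit Types (F G : 'rV[R]_n -> R).

(** Vectors carry the topology and tuples the sigma-algebra, so measurability of
a function of a vector is read through [vec_of_tuple]. *)
Definition borel F := measurable_fun [set: n.-tuple Rb] (F \o vec_of_tuple).

Lemma vec_of_tupleE (t : n.-tuple Rb) i : vec_of_tuple t 0 i = tnth t i.
Proof. by rewrite mxE. Qed.

(** This reduces the measurability of every integrand below, in several variables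
included, to that of coordinates. *)
Lemma borel_comp d (T : measurableType d) (g : T -> 'rV[R]_n) F :
  (forall i, measurable_fun [set: T] (fun t => g t 0 i)) -> borel F ->
  measurable_fun [set: T] (F \o g).
Proof.
move=> mg mF.
pose h (t : T) : n.-tuple Rb := [tuple g t 0 i | i < n].
have -> : F \o g = (F \o vec_of_tuple) \o h.
  apply/funext => t /=; congr F; apply/rowP => i.
  by rewrite vec_of_tupleE tnth_mktuple.
apply: (measurableT_comp mF); apply/measurable_fun_tnthP => i.
by apply: eq_measurable_fun (mg i) => t _ /=; rewrite tnth_mktuple.
Qed.

(** An open set is a countable union of rational cubes, and cubes are products of
intervals. *)
Lemma measurable_vec_open (O : set 'rV[R]_n) : open O ->
  measurable (vec_of_tuple @^-1` O : set (n.-tuple Rb)).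
Proof.
move=> oO.
pose box (q : 'rV[rat]_n) (k : nat) : set 'rV[R]_n :=
  [set x | forall i, `|x 0 i - ratr (q 0 i)| < k.+1%:R^-1].
have mbox q k : measurable (vec_of_tuple @^-1` box q k : set (n.-tuple Rb)).
  have -> : vec_of_tuple @^-1` box q k =
     \bigcap_(i in [set: 'I_n])
       ((fun t : n.-tuple Rb => tnth t i) @^-1`
         [set y | `|y - ratr (q 0 i)| < k.+1%:R^-1]).
    apply/seteqP; split => t /= H i.
      by move=> _; have := H i; rewrite vec_of_tupleE.
    by rewrite vec_of_tupleE; exact: H.
  apply: fin_bigcap_measurable => //.
  move=> i _; rewrite -[X in measurable X]setTI; apply: measurable_tnth => //.
  have -> : [set y : R | `|y - ratr (q 0 i)| < k.+1%:R^-1] =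
    [set` `](ratr (q 0 i) - k.+1%:R^-1), (ratr (q 0 i) + k.+1%:R^-1)[].
    by rewrite predeqE => y /=; rewrite in_itv/= ltr_distl.
  exact: measurable_itv.
have -> : vec_of_tuple @^-1` O =
  \bigcup_(p in [set p : 'rV[rat]_n * nat | box p.1 p.2 `<=` O])
     (vec_of_tuple @^-1` box p.1 p.2).
  apply/seteqP; split => t /=; last by case=> -[q k] /= bO /bO.
  move=> Ot; have /nbhs_ballP[e /= e0 eO] : nbhs (vec_of_tuple t) O.
    exact: open_nbhs_nbhs.
  pose k := Num.truncn (2 / e).
  have ke : k.+1%:R^-1 < e / 2.
    by rewrite invf_plt ?posrE ?divr_gt0// invf_div truncnS_gt.
  have rq i : {q : rat | `|vec_of_tuple t 0 i - ratr q| < k.+1%:R^-1}.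
    apply: cid; have /rat_in_itvoo[q] :
      vec_of_tuple t 0 i - k.+1%:R^-1 < vec_of_tuple t 0 i + k.+1%:R^-1.
      by rewrite ltrBlDr -addrA ltrDl addr_gt0.
    by rewrite in_itv /= -ltr_distl distrC => ?; exists q.
  exists (\row_i sval (rq i), k) => /=; last first.
    by move=> i; rewrite [in X in ratr X]mxE; case: (rq i).
  move=> y yb; apply: eO; split => // i j; rewrite ord1 -ball_normE /=.
  rewrite (_ : _ - _ = (vec_of_tuple t 0 j - ratr (sval (rq j))) -
     (y 0 j - ratr (sval (rq j)))); last by ring.
  apply: (le_lt_trans (ler_normB _ _)).
  rewrite (splitr e); apply: ltrD; apply: lt_trans ke; first by case: (rq j).
  by have := yb j; rewrite mxE.
rewrite bigcup_mkcond; apply: countable_bigcupT_measurable; first exact: countableP.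
by move=> p; case: ifP => _ //; exact: mbox.
Qed.

Lemma borel_continuous_on (O : set 'rV[R]_n) F : open O ->
  (forall x, O x -> {for x, continuous F}) -> borel (F \_ O).
Proof.
move=> oO cF.
have mO := measurable_vec_open oO; rewrite /borel.
have -> : (F \_ O) \o vec_of_tuple =
  (F \o vec_of_tuple) \_ (vec_of_tuple @^-1` O).
  by apply/funext => t; rewrite /= /patch/=; congr (if _ then _ else _).
apply/(measurable_restrictT _ mO).
apply: (measurability _ (RGenOpens.measurableE R)).
move=> _ [B [a [b ->{B}] <-]].
have -> : vec_of_tuple @^-1` O `&` (F \o vec_of_tuple) @^-1` `]a, b[ =
  vec_of_tuple @^-1` (O `&` F @^-1` `]a, b[%classic) by [].
apply: measurable_vec_open.
rewrite openE => x [Ox Fx]; apply: filterI; first exact: open_nbhs_nbhs.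
by apply: (cF x Ox); apply: open_nbhs_nbhs; split => //; exact: interval_open.
Qed.

Lemma borel_continuous F : continuous F -> borel F.
Proof.
move=> cF; have -> : F = F \_ setT by apply/funext => x; rewrite patchT// inE.
by apply: borel_continuous_on => // [|x _]; [exact: openT|exact: cF].
Qed.

End BorelRn.

(** * Translations and dilations *)

Section AffineChange.
Context {R : realType}.
Local Notation Rb := (measurableTypeR R).
Local Open Scope ereal_scope.

Lemma lebesgue_Rn_integral_cons n (f : n.+1.-tuple Rb -> \bar R) :
  measurable_fun setT f -> (forall t, 0 <= f t) ->
  \int[lebesgue_Rn n.+1]_t f t =
  \int[@lebesgue_measure R]_x \int[lebesgue_Rn n]_t f (cons_pair (x, t)).
Proof.
move=> mf f0.
have mc := @measurable_cons_pair R n.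
transitivity (\int[(@lebesgue_measure R) \x (lebesgue_Rn n)]_p f (cons_pair p)).
  transitivity (\int[pushforward ((@lebesgue_measure R) \x (lebesgue_Rn n))
    (@cons_pair R n)]_t f t) => //.
  by rewrite ge0_integral_pushforward.
rewrite (fubini_tonelli1 (fun p => f (cons_pair p)))//.
exact: measurableT_comp mf mc.
Qed.

(** The pushforward of the Lebesgue measure, multiplied by [a], agrees with the
Lebesgue measure on half-open intervals, hence everywhere. *)
Lemma lebesgue_affine1 (a c : R) (f : Rb -> \bar R) : (0 < a)%R ->
  measurable_fun setT f -> (forall t, 0 <= f t) ->
  \int[@lebesgue_measure R]_x f (a * x + c)%R =
  a^-1%:E * \int[@lebesgue_measure R]_x f x.
Proof.
move=> a0 mf f0.
pose phi (x : Rb) : Rb := (a * x + c)%R.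
have mphi : measurable_fun setT phi.
  by apply: measurable_funD => //; apply: measurable_funM.
have ann : (0 <= a)%R by exact: ltW.
have @P : {measure set Rb -> \bar R}.
  by unshelve refine (pushforward (@lebesgue_measure R) phi :
    {measure set Rb -> \bar R}).
pose Q : {measure set Rb -> \bar R} := mscale (NngNum ann) P.
have ocE (x y : R) : phi @^-1` `]x, y]%classic =
    `]((x - c) / a)%R, ((y - c) / a)%R]%classic.
  rewrite predeqE => z /=; rewrite !in_itv/= ltr_pdivrMr// ler_pdivlMr//.
  by rewrite /phi ltrBlDr lerBrDr (mulrC z).
have QE A : measurable A -> (@lebesgue_measure R) A = Q A.
  apply: lebesgue_measure_unique => _ [[x y] _ <-] /=.
  rewrite /Q /= /mscale/= /pushforward ocE !lebesgue_measure_itv/= !lte_fin.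
  rewrite ltr_pM2r ?invr_gt0// ltrD2r.
  case: ifP => _; last by rewrite mule0.
  by rewrite -!EFinD -EFinM; congr EFin; field; exact: lt0r_neq0.
rewrite [in RHS](eq_measure_integral Q); last by move=> A mA _; exact: QE.
rewrite ge0_integral_mscale// muleA -EFinM mulVf ?lt0r_neq0// mul1e.
by rewrite ge0_integral_pushforward.
Qed.

Definition affine_tuple n (a : R) (c t : n.-tuple Rb) : n.-tuple Rb :=
  [tuple (a * tnth t i + tnth c i)%R | i < n].

Lemma measurable_affine_tuple n a c :
  measurable_fun setT (@affine_tuple n a c).
Proof.
apply/measurable_fun_tnthP => i.
apply: (eq_measurable_fun (fun t => a * tnth t i + tnth c i)%R).
  by move=> t _ /=; rewrite tnth_mktuple.
apply: measurable_funD => //; apply: measurable_funM => //.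
exact: measurable_tnth.
Qed.

Lemma affine_cons_pair n a c0 (c : n.-tuple Rb) x t :
  affine_tuple a (cons_pair (c0, c)) (cons_pair (x, t)) =
  cons_pair ((a * x + c0)%R, affine_tuple a c t).
Proof.
apply: eq_from_tnth => i; rewrite tnth_mktuple.
case: (unliftP ord0 i) => [j|] ->; last by rewrite !tnth0.
by rewrite !tnthS tnth_mktuple.
Qed.

(** A translation composed with a homothety acts on each coordinate separately,
so the one-dimensional case and Tonelli give the general one by induction. *)
Lemma lebesgue_affine n (a : R) (c : n.-tuple Rb) (f : n.-tuple Rb -> \bar R) :
  (0 < a)%R -> measurable_fun setT f -> (forall t, 0 <= f t) ->
  \int[lebesgue_Rn n]_t f (affine_tuple a c t) =
  (a ^- n)%:E * \int[lebesgue_Rn n]_t f t.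
Proof.
move=> a0; elim: n c f => [|n IH] c f mf f0.
  rewrite expr0 invr1 mul1e; apply: eq_integral => t _; congr f.
  by rewrite [LHS]tuple0 [RHS]tuple0.
have ma := @measurable_affine_tuple n.+1 a c.
case/tupleP: c ma => c0 c ma.
have mfc : measurable_fun setT (fun p => f (cons_pair p)).
  exact: measurableT_comp mf (@measurable_cons_pair R n).
rewrite !lebesgue_Rn_integral_cons//; last exact: measurableT_comp mf ma.
pose g x := \int[lebesgue_Rn n]_t f (cons_pair (x, t)).
have mg : measurable_fun setT g.
  exact: (measurable_fun_fubini_tonelli_F (fun p => f (cons_pair p))).
have g0 x : 0 <= g x by exact: integral_ge0.
transitivity (\int[@lebesgue_measure R]_x ((a ^- n)%:E * g (a * x + c0)%R)).
  apply: eq_integral => x _; rewrite /g -(IH c)//.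
    by apply: eq_integral => t _; rewrite -affine_cons_pair.
  by apply: (measurableT_comp mfc); exact: pair1_measurable.
rewrite ge0_integralZl//; last 2 first.
- apply: (measurableT_comp mg).
  by apply: measurable_funD => //; apply: measurable_funM.
- by rewrite lee_fin invr_ge0 exprn_ge0// ltW.
by rewrite lebesgue_affine1// muleA -EFinM exprSr invfM mulrC.
Qed.

End AffineChange.

(** * Measure of boxes *)

Section BoxMeasure.
Context {R : realType}.
Local Notation Rb := (measurableTypeR R).

Lemma lebesgue_Rn_box n (D : 'I_n -> set Rb) : (forall i, measurable (D i)) ->
  measurable [set t : n.-tuple Rb | forall i, D i (tnth t i)] /\
  lebesgue_Rn n [set t : n.-tuple Rb | forall i, D i (tnth t i)] =
    (\prod_(i < n) @lebesgue_measure R (D i))%E.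
Proof.
move=> mD; split.
  have -> : [set t : n.-tuple Rb | forall i, D i (tnth t i)] =
     \bigcap_(i in [set: 'I_n]) ((fun t : n.-tuple Rb => tnth t i) @^-1` D i).
    by apply/seteqP; split => t /= H i; [move=> _|]; exact: H.
  apply: fin_bigcap_measurable => // i _.
  by rewrite -[X in measurable X]setTI; exact: measurable_tnth.
elim: n D mD => [|n IH] D mD.
  rewrite big_ord0 /= /dirac indicE mem_set// => i; first by case: i.
rewrite big_ord_recl /= /pushforward.
have -> : @cons_pair R n @^-1` [set t | forall i, D i (tnth t i)] =
   D ord0 `*` [set t | forall i, D (lift ord0 i) (tnth t i)].
  apply/seteqP; split => -[x t] /=.
    move=> H; split; first by have := H ord0; rewrite tnth0.
    by move=> i; have := H (lift ord0 i); rewrite tnthS.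
  move=> [H0 H] i; case: (unliftP ord0 i) => [j|] ->; last by rewrite tnth0.
  by rewrite tnthS.
rewrite product_measure1E//; last first.
  have -> : [set t : n.-tuple Rb | forall i, D (lift ord0 i) (tnth t i)] =
     \bigcap_(i in [set: 'I_n])
       ((fun t : n.-tuple Rb => tnth t i) @^-1` D (lift ord0 i)).
    by apply/seteqP; split => t /= H i; [move=> _|]; exact: H.
  apply: fin_bigcap_measurable => // i _.
  by rewrite -[X in measurable X]setTI; exact: measurable_tnth.
by congr (_ * _)%E; exact: (IH (fun i => D (lift ord0 i))).
Qed.

Lemma lebesgue_Rn_cube n (p : 'rV[R]_n) (r : R) : 0 < r ->
  measurable (vec_of_tuple @^-1` [set x : 'rV[R]_n | forall i, `|p 0 i - x 0 i| < r]
     : set (n.-tuple Rb)) /\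
  lebesgue_Rn n (vec_of_tuple @^-1` [set x : 'rV[R]_n | forall i, `|p 0 i - x 0 i| < r])
  = ((2 * r) ^+ n)%:E.
Proof.
move=> r0.
pose D i : set Rb := `](p 0 i - r), (p 0 i + r)[%classic.
have mD i : measurable (D i) by exact: measurable_itv.
have [m1 m2] := lebesgue_Rn_box mD.
have -> : vec_of_tuple @^-1` [set x : 'rV[R]_n | forall i, `|p 0 i - x 0 i| < r]
   = [set t : n.-tuple Rb | forall i, D i (tnth t i)].
  apply/seteqP; split => t /= H i; have := H i;
    by rewrite /D /= in_itv/= vec_of_tupleE -ltr_distl distrC.
split=> //; rewrite m2 (eq_bigr (fun=> (2 * r)%:E)); last first.
  move=> i _; rewrite /D lebesgue_measure_itv/= lte_fin ltrD2l gtrN//.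
  by rewrite -EFinD; congr EFin; ring.
by rewrite prodEFin prodr_const card_ord.
Qed.

End BoxMeasure.

(** * Integration of bounded functions with bounded support *)

Section Functional.
Context {R : realType} {n : nat}.
Local Notation Rb := (measurableTypeR R).
Implicit Types (f g F G : 'rV[R]_n -> R).

Definition bounded_by M f := forall x, `|f x| <= M.
Definition supported_in r f := forall x, f x != 0 -> `|x| < r.

(** On this class, stable under all the operations that occur below, the integral
is finite and linear, so that signed identities need no integrability side
conditions. *)
Record tame f : Prop := Tame {
  tame_borel : borel f ;
  tame_bounded : exists M, bounded_by M f ;
  tame_support : exists r, supported_in r f }.

Definition intRn f : R := \int[lebesgue_Rn n]_t f (vec_of_tuple t).

Lemma cubeE r : 0 < r -> [set x : 'rV[R]_n | `|x| < r] =
  [set x : 'rV[R]_n | forall i, `|(0 : 'rV[R]_n) 0 i - x 0 i| < r].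
Proof.
move=> r0; apply/seteqP; split => x /=.
  move=> xr i; rewrite mxE sub0r normrN; apply: le_lt_trans xr.
  by rewrite -[`|x|]/(mx_norm x) mx_normrE; apply/bigmax_geP; right => /=; exists (0, i).
move=> H; rewrite -[`|x|]/(mx_norm x) mx_normrE; apply/bigmax_ltP; split => //.
by move=> [i j] _ /=; rewrite ord1; have := H j; rewrite mxE sub0r normrN.
Qed.

Lemma borel_cst (c : R) : borel (fun _ : 'rV[R]_n => c).
Proof. exact: measurable_cst. Qed.

Lemma borelD F G : borel F -> borel G -> borel (fun x => F x + G x).
Proof. by move=> mF mG; apply: measurable_funD. Qed.

Lemma borelM F G : borel F -> borel G -> borel (fun x => F x * G x).
Proof. by move=> mF mG; apply: measurable_funM. Qed.

Lemma borelB F G : borel F -> borel G -> borel (fun x => F x - G x).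
Proof. by move=> mF mG; apply: measurable_funB. Qed.

Lemma borelN F : borel F -> borel (fun x => - F x).
Proof. by move=> mF; rewrite (_ : (fun _ => _) = (fun x => 0 - F x));
 [exact: borelB (borel_cst _) mF | apply/funext => x; rewrite sub0r]. Qed.

Lemma borel_norm F : borel F -> borel (fun x => `|F x|).
Proof. by move=> mF; apply: measurableT_comp mF. Qed.

Lemma borel_sum (I : Type) (r : seq I) (P : pred I) (F : I -> 'rV[R]_n -> R) :
  (forall i, borel (F i)) -> borel (fun x => \sum_(i <- r | P i) F i x).
Proof.
move=> mF; elim: r => [|i r IH].
  rewrite (_ : (fun _ => _) = (fun=> 0)); first exact: borel_cst.
  by apply/funext => x; rewrite big_nil.
case Pi : (P i); last first.
  rewrite (_ : (fun _ => _) = (fun x => \sum_(i <- r | P i) F i x)) //.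
  by apply/funext => x; rewrite big_cons Pi.
rewrite (_ : (fun _ => _) = (fun x => F i x + \sum_(i <- r | P i) F i x)).
  exact: borelD.
by apply/funext => x; rewrite big_cons Pi.
Qed.

Lemma borel_shift F (a : 'rV[R]_n) (s : R) : borel F -> borel (fun x => F (a + s *: x)).
Proof.
move=> mF; apply: (@borel_comp _ _ _ _ (fun t : n.-tuple Rb => a + s *: vec_of_tuple t)) mF.
move=> i; apply: (eq_measurable_fun (fun t : n.-tuple Rb => a 0 i + s * tnth t i)).
  by move=> t _; rewrite !mxE.
by apply: measurable_funD => //; apply: measurable_funM => //; exact: measurable_tnth.
Qed.

Lemma tame_integrable f : tame f ->
  (lebesgue_Rn n).-integrable setT (EFin \o (f \o vec_of_tuple)).
Proof.
case=> mf [M fM] [r0 fr0].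
pose r := Num.max r0 1.
have rgt0 : 0 < r by rewrite lt_max ltr01 orbT.
have fr : supported_in r f.
  by move=> x /fr0 xr; rewrite lt_max xr.
have [mc ec] := lebesgue_Rn_cube (0 : 'rV[R]_n) rgt0.
rewrite -(cubeE rgt0) in mc ec.
set C := vec_of_tuple @^-1` _ in mc ec.
have -> : EFin \o (f \o vec_of_tuple) = (EFin \o (f \o vec_of_tuple)) \_ C.
  apply/funext => t; rewrite /patch /=; case: ifPn => // tC.
  congr EFin; apply/eqP; apply: contraNT tC => /fr ?.
  by rewrite inE.
apply/(integrable_mkcond _ mc).
apply: measurable_bounded_integrable => //.
- by rewrite /= ec ltry.
- exact: measurable_funTS.
- exists M; split; first by rewrite num_real.
  by move=> K MK t _ /=; apply: le_trans (fM _) (ltW MK).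
Qed.

Lemma EFin_intRn f : tame f ->
  (intRn f)%:E = (\int[lebesgue_Rn n]_t (f (vec_of_tuple t))%:E)%E.
Proof.
by move=> bf; rewrite /intRn /Rintegral fineK//; exact: integrable_fin_num (tame_integrable bf).
Qed.

Lemma tame_le f g : borel f -> tame g -> (forall x, `|f x| <= `|g x|) -> tame f.
Proof.
move=> mf [mg [M gM] [r gr]] fg; split => //.
  by exists M => x; apply: le_trans (fg x) (gM x).
by exists r => x fx; apply: gr; apply: contraNneq fx => gx0;
  have := fg x; rewrite gx0 normr0 normr_le0.
Qed.

Lemma tame0 : tame (fun=> 0).
Proof.
split; first exact: borel_cst.
  by exists 0 => x; rewrite normr0.
by exists 0 => x; rewrite eqxx.
Qed.

Lemma tameD f g : tame f -> tame g -> tame (fun x => f x + g x).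
Proof.
move=> [mf [M fM] [r fr]] [mg [N gN] [s gs]]; split; first exact: borelD.
  by exists (M + N) => x; apply: le_trans (ler_normD _ _) (lerD (fM x) (gN x)).
exists (Num.max r s) => x fgx; rewrite lt_max.
have [fx0|/fr ->//] := eqVneq (f x) 0.
by rewrite gs ?orbT//; move: fgx; rewrite fx0 add0r.
Qed.

Lemma tameM f g : tame f -> borel g -> (exists M, bounded_by M g) ->
  tame (fun x => f x * g x).
Proof.
move=> [mf [M fM] [r fr]] mg [N gN]; split; first exact: borelM.
  exists (M * N) => x; rewrite normrM.
  by apply: ler_pM => //.
by exists r => x; rewrite mulf_eq0 negb_or => /andP[/fr].
Qed.

Lemma tameZ (c : R) f : tame f -> tame (fun x => c * f x).
Proof.
move=> bf; rewrite (_ : (fun _ => _) = (fun x => f x * c)).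
  by apply: tameM => //; [exact: borel_cst | exists `|c| => x].
by apply/funext => x; rewrite mulrC.
Qed.

Lemma tameN f : tame f -> tame (fun x => - f x).
Proof.
move=> bf; rewrite (_ : (fun _ => _) = (fun x => (-1) * f x)); first exact: tameZ.
by apply/funext => x; rewrite mulN1r.
Qed.

Lemma tameB f g : tame f -> tame g -> tame (fun x => f x - g x).
Proof. by move=> bf bg; apply: tameD bf (tameN bg). Qed.

Lemma tame_norm f : tame f -> tame (fun x => `|f x|).
Proof.
by move=> bf; apply: (tame_le _ bf) => [|x]; [exact: borel_norm (tame_borel bf)|rewrite normr_id].
Qed.

Lemma tame_sum (I : Type) (r : seq I) (P : pred I) (F : I -> 'rV[R]_n -> R) :
  (forall i, tame (F i)) -> tame (fun x => \sum_(i <- r | P i) F i x).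
Proof.
move=> mF; elim: r => [|i r IH].
  rewrite (_ : (fun _ => _) = (fun=> 0)); first exact: tame0.
  by apply/funext => x; rewrite big_nil.
case Pi : (P i); last first.
  rewrite (_ : (fun _ => _) = (fun x => \sum_(i <- r | P i) F i x)) //.
  by apply/funext => x; rewrite big_cons Pi.
rewrite (_ : (fun _ => _) = (fun x => F i x + \sum_(i <- r | P i) F i x)).
  exact: tameD.
by apply/funext => x; rewrite big_cons Pi.
Qed.

Lemma tame_shift f (a : 'rV[R]_n) (s : R) : s != 0 -> tame f ->
  tame (fun x => f (a + s *: x)).
Proof.
move=> s0 [mf [M fM] [r fr]]; split; first exact: borel_shift.
  by exists M => x; exact: fM.
exists (`|s|^-1 * (r + `|a|)) => x /fr H.
rewrite -(ltr_pM2l (x := `|s|)) ?normr_gt0// mulrA divff ?normr_eq0// mul1r.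
rewrite -normrZ; have -> : s *: x = (a + s *: x) - a by rewrite addrC addKr.
by apply: le_lt_trans (ler_normB _ _) _; rewrite ltrD2r.
Qed.

Lemma borel_indic (A : set 'rV[R]_n) :
  measurable (vec_of_tuple @^-1` A : set (n.-tuple Rb)) -> borel (\1_A : 'rV[R]_n -> R).
Proof.
move=> mA; rewrite /borel.
have -> : (\1_A : 'rV[R]_n -> R) \o vec_of_tuple = \1_(vec_of_tuple @^-1` A) by [].
exact: measurable_indic.
Qed.

Lemma tame_indic (A : set 'rV[R]_n) r :
  measurable (vec_of_tuple @^-1` A : set (n.-tuple Rb)) ->
  A `<=` [set x | `|x| < r] -> tame (\1_A : 'rV[R]_n -> R).
Proof.
move=> mA Ar; split; first exact: borel_indic.
  by exists 1 => x; rewrite indicE; case: (_ \in _); rewrite ?normr1 ?normr0.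
exists r => x; rewrite indicE; case: (boolP (x \in A)) => [|_]; last by rewrite eqxx.
by rewrite inE => /Ar.
Qed.

Lemma intRnD f g : tame f -> tame g -> intRn (fun x => f x + g x) = intRn f + intRn g.
Proof. by move=> bf bg; apply: RintegralD => //; exact: tame_integrable. Qed.

Lemma intRnB f g : tame f -> tame g -> intRn (fun x => f x - g x) = intRn f - intRn g.
Proof. by move=> bf bg; apply: RintegralB => //; exact: tame_integrable. Qed.

Lemma intRnZ c f : tame f -> intRn (fun x => c * f x) = c * intRn f.
Proof. by move=> bf; apply: RintegralZl => //; exact: tame_integrable. Qed.

Lemma intRnN f : tame f -> intRn (fun x => - f x) = - intRn f.
Proof.
move=> bf; rewrite -mulN1r -intRnZ//; congr intRn; apply/funext => x.
by rewrite mulN1r.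
Qed.

Lemma intRn0 : intRn (fun=> 0) = 0.
Proof. by rewrite /intRn Rintegral_cst// mul0r. Qed.

Lemma intRn_sum (I : Type) (r : seq I) (P : pred I) (F : I -> 'rV[R]_n -> R) :
  (forall i, tame (F i)) ->
  intRn (fun x => \sum_(i <- r | P i) F i x) = \sum_(i <- r | P i) intRn (F i).
Proof.
move=> mF; elim: r => [|i r IH].
  rewrite big_nil -[RHS]intRn0; congr intRn.
  by apply/funext => x; rewrite big_nil.
rewrite big_cons; case Pi : (P i); last first.
  by rewrite -IH; congr intRn; apply/funext => x; rewrite big_cons Pi.
rewrite -IH -intRnD//; last exact: tame_sum.
by congr intRn; apply/funext => x; rewrite big_cons Pi.
Qed.

Lemma le_intRn f g : tame f -> tame g -> (forall x, f x <= g x) -> intRn f <= intRn g.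
Proof.
by move=> bf bg fg; apply: le_Rintegral => // ; exact: tame_integrable.
Qed.

Lemma intRn_ge0 f : (forall x, 0 <= f x) -> 0 <= intRn f.
Proof. by move=> f0; apply: Rintegral_ge0. Qed.

Lemma normr_intRn f : tame f -> `|intRn f| <= intRn (fun x => `|f x|).
Proof. by move=> bf; apply: le_normr_Rintegral => //; exact: tame_integrable. Qed.

Lemma normr_intRn_le f g : tame f -> tame g -> (forall x, `|f x| <= g x) ->
  `|intRn f| <= intRn g.
Proof.
move=> bf bg fg; apply: le_trans (normr_intRn bf) _.
by apply: le_intRn => //; exact: tame_norm.
Qed.

Definition eborel (f : 'rV[R]_n -> \bar R) :=
  measurable_fun [set: n.-tuple Rb] (f \o vec_of_tuple).

Lemma eintegral_affine (f : 'rV[R]_n -> \bar R) (a : 'rV[R]_n) (s : R) :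
  0 < s -> eborel f -> (forall x, (0 <= f x)%E) ->
  (\int[lebesgue_Rn n]_t f (a + s *: vec_of_tuple t)%R =
  (s ^- n)%:E * \int[lebesgue_Rn n]_t f (vec_of_tuple t))%E.
Proof.
move=> s0 mf f0.
rewrite -(lebesgue_affine [tuple a 0 i | i < n] s0 mf); last by move=> t; exact: f0.
apply: eq_integral => t _ /=; congr f; apply/rowP => i.
by rewrite !mxE !tnth_mktuple addrC.
Qed.

Lemma intRn_shift f (a : 'rV[R]_n) : tame f -> intRn (fun x => f (a + x)) = intRn f.
Proof.
move=> bf; congr fine.
rewrite [LHS]integralE [RHS]integralE.
have mf : measurable_fun setT (EFin \o (f \o vec_of_tuple)).
  by apply/measurable_EFinP; exact: tame_borel.
pose p (s x : R) := (Num.max (s * x) 0)%:E.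
have pE s t : (0 <= p s t)%E by rewrite lee_fin le_max lexx orbT.
have mp s : eborel (fun x => p s (f x)).
  apply/measurable_EFinP; apply: measurable_maxr => //.
  by apply: measurable_funM => //; exact: tame_borel.
have E s := eintegral_affine a ltr01 (mp s) (fun x => pE _ _).
rewrite (_ : (fun x => _)^\+%E = (fun t => p 1 (f (a + 1 *: vec_of_tuple t)))); last first.
  by apply/funext => t; rewrite unlock /p mul1r scale1r EFin_max.
rewrite (_ : (fun x => _)^\-%E = (fun t => p (-1) (f (a + 1 *: vec_of_tuple t)))); last first.
  by apply/funext => t; rewrite unlock /p mulN1r scale1r EFin_max.
rewrite !E expr1n invr1 !mul1e; congr (_ - _)%E; apply: eq_integral => t _.
  by rewrite unlock /p mul1r EFin_max.
by rewrite unlock /p mulN1r EFin_max.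
Qed.

End Functional.

(** * Directional derivatives and integration by parts *)

Section Calculus.
Context {R : realType} {n : nat}.
Implicit Types (f g F G : 'rV[R]_n -> R) (x y z v : 'rV[R]_n).

(** Directional derivatives are derivatives of one variable, for which the chain
rule is available. *)
Lemma is_derive_lineP f z v d :
  is_derive z v f d <-> is_derive (0 : R) 1 (fun h => f (z + h *: v)) d.
Proof.
have E : (fun h : R => h^-1 *: ((f \o shift z) (h *: v) - f z)) =
  (fun h => h^-1 *: (((fun h => f (z + h *: v)) \o shift 0) (h *: 1) -
     (fun h => f (z + h *: v)) 0)).
  apply/funext => h /=; rewrite scale0r !addr0 (addrC (h *: v)).
  by rewrite [h *: 1]mulr1.
split=> -[H1 H2]; split.
- by rewrite /derivable -E.
- by rewrite /derive -E.
- by rewrite /derivable E.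
- by rewrite /derive E.
Qed.

Lemma is_derive_affine F x (s : R) z v d :
  is_derive (x + s *: z) v F d ->
  is_derive z v (fun z => F (x + s *: z)) (s * d).
Proof.
move=> /is_derive_lineP H; apply/is_derive_lineP.
have -> : (fun h => F (x + s *: (z + h *: v))) =
   (fun h => F (x + s *: z + h *: v)) \o (fun h => s *: h).
  by apply/funext => h /=; rewrite scalerDr addrA scalerA.
have H1 : is_derive (0 : R) 1 (fun h : R => s *: h) s.
  have := @is_deriveZ _ _ _ (@id R) s 0 1 1 (is_derive_id _ _).
  by rewrite [s *: 1]mulr1.
have H2 : is_derive (s *: (0:R)) 1 (fun h => F (x + s *: z + h *: v)) d.
  by rewrite scaler0.
by have := is_derive1_comp H2 H1; rewrite mulrC.
Qed.

Lemma is_derive_line f a v (s : R) d : is_derive (a + s *: v) v f d ->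
  is_derive s 1 (fun s => f (a + s *: v)) d.
Proof.
have E : (fun h : R => h^-1 *: ((f \o shift (a + s *: v)) (h *: v) - f (a + s *: v))) =
  (fun h => h^-1 *: (((fun h => f (a + h *: v)) \o shift s) (h *: 1) -
     (fun h => f (a + h *: v)) s)).
  apply/funext => h /=; rewrite [h *: 1]mulr1 scalerDl.
  by rewrite addrCA.
move=> -[H1 H2]; split.
- by rewrite /derivable -E.
- by rewrite /derive -E.
Qed.

Lemma is_derive_partial F y v : differentiable F y ->
  is_derive y v F (\sum_j v 0 j * partial j F y).
Proof.
move=> dF; split; first exact: diff_derivable.
rewrite deriveE// {1}(row_sum_delta v) linear_sum; apply: eq_bigr => j _.
by rewrite linearZ /partial deriveE.
Qed.

Lemma mean_value_line f g a v (h : R) : 0 <= h ->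
  (forall s : R, is_derive (a + s *: v) v f (g (a + s *: v))) ->
  exists c : R, f (a + h *: v) - f a = g (a + c *: v) * h.
Proof.
move=> h0 df.
have dphi (s : R) : is_derive s 1 (fun s => f (a + s *: v)) (g (a + s *: v)).
  exact: is_derive_line (df s).
have [|c _ E] := @MVT_segment R (fun s => f (a + s *: v))
    (fun s => g (a + s *: v)) 0 h h0
  (fun s _ => dphi s).
  apply/continuous_subspaceT => s.
  apply: differentiable_continuous; apply/derivable1_diffP.
  exact: ex_derive.
by exists c; move: E; rewrite /= scale0r addr0 subr0.
Qed.

(** By translation invariance the difference quotients of [f] have integral zero.
They are bounded by [M] by the mean value theorem, so dominated convergence
applies. *)
Lemma intRn_derive_eq0 f g v M : tame f -> borel g -> bounded_by M g ->
  (forall z, is_derive z v f (g z)) -> intRn g = 0.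
Proof.
move=> bf mg gM df.
pose h (k : nat) : R := k.+1%:R^-1.
have h0 k : 0 < h k by rewrite /h invr_gt0 ltr0n.
have h1 k : h k <= 1 by rewrite /h invf_le1// ler1n.
pose q k z := (h k)^-1 * (f (z + h k *: v) - f z).
have hto : h @ \oo --> (0 : R)^'.
  move=> A /= /nbhs_ballP [e e0 HA].
  change (\forall k \near \oo, A (h k)); near=> k.
  apply: HA; last by rewrite gt_eqF.
  rewrite -ball_normE /= sub0r normrN gtr0_norm//.
  by near: k; exact: (near_infty_natSinv_lt (PosNum e0)).
have bsh k : tame (fun z => f (z + h k *: v)).
  rewrite (_ : (fun _ => _) = (fun z => f (h k *: v + 1 *: z))); last first.
    by apply/funext => z; rewrite scale1r addrC.
  by apply: tame_shift => //; exact: oner_neq0.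
have bq k : tame (q k) by apply: tameZ; apply: tameB.
have Iq k : intRn (q k) = 0.
  rewrite intRnZ ?intRnB//; last exact: tameB.
  have -> : intRn (fun z => f (z + h k *: v)) = intRn f.
    rewrite -(intRn_shift (h k *: v) bf); congr intRn; apply/funext => z.
    by rewrite addrC.
  by rewrite subrr mulr0.
have qM k z : `|q k z| <= M.
  have [c Ec] := mean_value_line (ltW (h0 k)) (fun s => df (z + s *: v)).
  by rewrite /q Ec mulrCA mulVf ?mulr1 ?gM// gt_eqF.
have [r fr] := tame_support bf.
pose r' := Num.max (r + `|v|) 1.
have r'0 : 0 < r' by rewrite lt_max ltr01 orbT.
have qr k z : q k z != 0 -> `|z| < r'.
  move=> qz; rewrite lt_max; apply/orP; left.
  have [fz0|/fr] := eqVneq (f z) 0; last first.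
    by move=> /lt_le_trans; apply; rewrite lerDl.
  have /fr : f (z + h k *: v) != 0.
    by apply: contraNneq qz => e; rewrite /q e fz0 subrr mulr0.
  move=> H; have -> : z = (z + h k *: v) - h k *: v by rewrite addrK.
  apply: le_lt_trans (ler_normB _ _) _; apply: ltr_leD => //.
  by rewrite normrZ gtr0_norm// ler_piMl.
have [mc _] := lebesgue_Rn_cube (0 : 'rV[R]_n) r'0.
rewrite -(cubeE r'0) in mc.
set C := [set x : 'rV[R]_n | `|x| < r'] in mc.
pose dom z := M * \1_C z.
have M0 : 0 <= M by apply: le_trans (normr_ge0 _) (gM 0).
have idom : tame dom by apply: tameZ; apply: (tame_indic mc (r := r')) => x.
have qg : {ae lebesgue_Rn n, forall t, setT t ->
    (fun k => (q k (vec_of_tuple t))%:E) @ \oo --> (g (vec_of_tuple t))%:E}.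
  apply: aeW => t _; apply: cvg_EFin; first by apply: nearW.
  have [dz ez] := df (vec_of_tuple t).
  have : (fun h => h^-1 *: ((f \o shift (vec_of_tuple t)) (h *: v)
      - f (vec_of_tuple t))) @ (0 : R)^' --> g (vec_of_tuple t).
    by rewrite -ez; exact: dz.
  move=> /(cvg_comp _ _ hto); apply: cvg_trans; apply: near_eq_cvg.
  by apply: nearW => k /=; rewrite /q (addrC (h k *: v)).
have qdom : {ae lebesgue_Rn n, forall t k, setT t ->
    (`|(q k (vec_of_tuple t))%:E| <= (dom (vec_of_tuple t))%:E)%E}.
  apply: aeW => t k _; rewrite /dom /= lee_fin indicE.
  case: (boolP (vec_of_tuple t \in C)) => tC; first by rewrite mulr1 qM.
  rewrite mulr0 normr_le0; apply: contraNT tC => /qr ?.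
  by rewrite inE.
have [_ _ H] := dominated_convergence measurableT
  (fun k => (measurable_EFinP _ _).2 (tame_borel (bq k)))
  ((measurable_EFinP _ _).2 mg) qg (tame_integrable idom) qdom.
have {}H : (cst 0%E : nat -> \bar R) @ \oo -->
   (\int[lebesgue_Rn n]_t (g (vec_of_tuple t))%:E)%E.
  apply: cvg_trans H; apply: near_eq_cvg; apply: nearW => k /=.
  by rewrite -EFin_intRn// Iq.
rewrite /intRn /Rintegral.
by have /cvg_lim <- // := H; rewrite lim_cst.
Unshelve. all: by end_near. Qed.

End Calculus.

(** * The Euclidean norm *)

Section EuclideanNorm.
Context {R : realType} {n : nat}.
Implicit Types (x y z : 'rV[R]_n).

Definition sqn x : R := \sum_i x 0 i ^+ 2.

Lemma sqn_ge0 x : 0 <= sqn x.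
Proof. by apply: sumr_ge0 => i _; exact: sqr_ge0. Qed.

Lemma enorm_ge0 x : 0 <= enorm x.
Proof. exact: sqrtr_ge0. Qed.

Lemma enorm_sqr x : enorm x ^+ 2 = sqn x.
Proof. by rewrite sqr_sqrtr// sqn_ge0. Qed.

Lemma coord_le_enorm x i : `|x 0 i| <= enorm x.
Proof.
rewrite -(ler_pXn2r (n := 2))// ?nnegrE ?enorm_ge0// enorm_sqr real_normK ?num_real//.
by rewrite /sqn (bigD1 i)//= lerDl; apply: sumr_ge0 => j _; exact: sqr_ge0.
Qed.

Lemma norm_le_enorm x : `|x| <= enorm x.
Proof.
rewrite -[`|x|]/(mx_norm x) mx_normrE; apply/bigmax_leP; split.
  exact: enorm_ge0.
by move=> [i j] _ /=; rewrite ord1; exact: coord_le_enorm.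
Qed.

Lemma enorm_le_sum x : enorm x <= \sum_i `|x 0 i|.
Proof.
have s0 : 0 <= \sum_i `|x 0 i| by apply: sumr_ge0.
rewrite -(ler_pXn2r (n := 2))// ?nnegrE ?enorm_ge0// enorm_sqr expr2 mulr_suml.
apply: ler_sum => i _; rewrite -real_normK ?num_real// expr2 ler_wpM2l//.
by rewrite (bigD1 i)//= lerDl; apply: sumr_ge0.
Qed.

Lemma enormZ (s : R) x : enorm (s *: x) = `|s| * enorm x.
Proof.
rewrite /enorm -sqrtr_sqr -sqrtrM ?sqr_ge0// mulr_sumr.
by congr Num.sqrt; apply: eq_bigr => i _; rewrite mxE exprMn.
Qed.

Lemma enorm0 : enorm (0 : 'rV[R]_n) = 0.
Proof. by have := enormZ 0 0; rewrite scale0r normr0 mul0r. Qed.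

Lemma enormN x : enorm (- x) = enorm x.
Proof. by rewrite -scaleN1r enormZ normrN1 mul1r. Qed.

Lemma enorm_eq0 x : enorm x = 0 -> x = 0.
Proof.
move=> e; apply/rowP => i; rewrite mxE; apply/eqP; rewrite -normr_eq0.
by rewrite eq_le normr_ge0 andbT -e coord_le_enorm.
Qed.

Lemma enormD x y : enorm (x + y) <= enorm x + enorm y.
Proof.
have [x0|x0] := eqVneq (enorm x) 0.
  by rewrite (enorm_eq0 x0) add0r enorm0 add0r.
have [y0|y0] := eqVneq (enorm y) 0.
  by rewrite (enorm_eq0 y0) addr0 enorm0 addr0.
have px : 0 < enorm x by rewrite lt_neqAle eq_sym x0 enorm_ge0.
have py : 0 < enorm y by rewrite lt_neqAle eq_sym y0 enorm_ge0.
rewrite -(ler_pXn2r (n := 2))// ?nnegrE ?addr_ge0 ?enorm_ge0//.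
rewrite sqrrD !enorm_sqr.
pose c := enorm y / enorm x.
have c0 : 0 < c by rewrite divr_gt0.
have -> : enorm x * enorm y *+ 2 = c * sqn x + c^-1 * sqn y.
  rewrite -!enorm_sqr /c mulr2n; field; exact/andP.
rewrite /sqn !mulr_sumr -!big_split/=; apply: ler_sum => i _; rewrite mxE.
have : 0 <= c^-1 * (c * x 0 i - y 0 i) ^+ 2.
  by rewrite mulr_ge0 ?sqr_ge0// invr_ge0 ltW.
have -> : c^-1 * (c * x 0 i - y 0 i) ^+ 2 =
  c * x 0 i ^+ 2 + c^-1 * y 0 i ^+ 2 - 2 * x 0 i * y 0 i.
  by field; rewrite gt_eqF.
by lra.
Qed.

Lemma sqn_continuous : continuous sqn.
Proof.
apply: continuous_big => [|i _ x]; first exact: add_continuous.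
apply: (@continuous_comp _ _ _ (fun x : 'rV[R]_n => x 0 i) (fun t : R => t ^+ 2)).
  exact: coord_continuous.
exact: exprn_continuous.
Qed.

Lemma enorm_continuous : continuous (@enorm R n).
Proof.
move=> x; apply: continuous_comp; [exact: sqn_continuous|exact: sqrt_continuous].
Qed.

Lemma open_eball (r : R) : open (@eball R n r).
Proof.
have -> : @eball R n r = enorm @^-1` [set y | y < r] by [].
by apply: open_comp => [x _|]; [exact: enorm_continuous|exact: open_lt].
Qed.

Lemma closed_eclosed_ball (r : R) : closed (@eclosed_ball R n r).
Proof.
have -> : @eclosed_ball R n r = enorm @^-1` [set y | y <= r] by [].
by have /continuous_closedP := enorm_continuous; apply; exact: closed_le.
Qed.

Lemma compact_eclosed_ball (r : R) : compact (@eclosed_ball R n r).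
Proof.
apply: bounded_closed_compact; last exact: closed_eclosed_ball.
exists r; split; first exact: num_real.
by move=> M rM x xr; apply: le_trans (norm_le_enorm x) (le_trans xr (ltW rM)).
Qed.

Lemma borel_sqn : borel sqn.
Proof. by apply: borel_continuous; exact: sqn_continuous. Qed.

Lemma borel_coord i : borel (fun x : 'rV[R]_n => x 0 i).
Proof. by apply: borel_continuous; exact: coord_continuous. Qed.

End EuclideanNorm.

(** * Radial profiles *)

Section Profile.
Context {R : realType}.
Implicit Types (s t h : R).

Definition ramp t : R := Num.max t 0.

Lemma ramp_ge0 t : 0 <= ramp t.
Proof. by rewrite le_max lexx orbT. Qed.

Lemma ramp_id t : 0 <= t -> ramp t = t.
Proof. by move=> t0; rewrite /ramp; apply/max_idPl. Qed.

Lemma ramp_eq0 t : t <= 0 -> ramp t = 0.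
Proof. by move=> t0; rewrite /ramp; apply/max_idPr. Qed.

Lemma ramp_lip s t : `|ramp s - ramp t| <= `|s - t|.
Proof.
by rewrite /ramp; case: (leP s 0) => s0; case: (leP t 0) => t0; rewrite ler_norml;
  case: (ler0P (s - t)) => st; apply/andP; split; lra.
Qed.

(** Stated uniformly in the signs of [t] and [t + h], this gives the derivative of
the squared ramp without treating the kink at zero apart. *)
Lemma ramp_sqr_taylor t h : `|ramp (t + h) ^+ 2 - ramp t ^+ 2 - 2 * ramp t * h| <= h ^+ 2.
Proof.
rewrite /ramp; case: (leP (t + h) 0) => s0; case: (leP t 0) => t0;
  rewrite ler_norml; apply/andP; split; nra.
Qed.

Lemma is_derive_ramp_sqr t : is_derive t 1 (fun t => ramp t ^+ 2) (2 * ramp t).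
Proof.
have H : (fun h : R => h^-1 *: (((fun t => ramp t ^+ 2) \o shift t) (h *: 1) - ramp t ^+ 2))
   @ (0 : R)^' --> 2 * ramp t.
  apply/cvgrPdist_le => e e0; near=> h.
  have h0 : h != 0 by near: h; exact: nbhs_dnbhs_neq.
  rewrite /= [h *: 1]mulr1 [h^-1 *: _]/(h^-1 * _) (addrC h).
  have -> : 2 * ramp t - h^-1 * (ramp (t + h) ^+ 2 - ramp t ^+ 2) =
     - (h^-1 * (ramp (t + h) ^+ 2 - ramp t ^+ 2 - 2 * ramp t * h)) by field.
  rewrite normrN normrM normfV ler_pdivrMl ?normr_gt0//.
  apply: le_trans (ramp_sqr_taylor t h) _.
  rewrite -real_normK ?num_real// expr2 ler_pM2l ?normr_gt0//.
  near: h; apply: dnbhs0_le; exact: e0.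
by split; [apply/cvg_ex; eexists; exact: H | exact: cvg_lim H].
Unshelve. all: by end_near. Qed.

Variables (a b : R).

(** As functions of the squared norm of [z], [bump] is a [C^1] cut-off, constant
for [|z| ^ 2 <= a] and zero for [b <= |z| ^ 2], and [shell] is minus twice its
derivative, so that [bump (|z| ^ 2)] has gradient [- shell (|z| ^ 2) z]. *)
Definition bump_core t : R := (b - a) ^+ 2 - ramp (t - a) ^+ 2.
Definition bump t : R := ramp (bump_core t) ^+ 2.
Definition shell t : R := 8 * ramp (bump_core t) * ramp (t - a).

Lemma is_derive_bump t : is_derive t 1 bump (- (shell t / 2)).
Proof.
have H1 : is_derive t 1 bump_core (- (2 * ramp (t - a))).
  have dm : is_derive t 1 (fun t => t - a) 1.
    by have := is_deriveB (is_derive_id t 1) (is_derive_cst a t 1); rewrite subr0.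
  have dp := @is_derive1_comp R (fun t => ramp t ^+ 2) (fun t => t - a) t _ _
    (is_derive_ramp_sqr (t - a)) dm.
  have := is_deriveB (is_derive_cst ((b - a) ^+ 2) t 1) dp.
  by rewrite sub0r mulr1.
have := @is_derive1_comp R (fun t => ramp t ^+ 2) bump_core t _ _
  (is_derive_ramp_sqr (bump_core t)) H1.
by rewrite (_ : 2 * ramp (bump_core t) * - (2 * ramp (t - a)) = - (shell t / 2))// /shell; field.
Qed.

Lemma shell_ge0 t : 0 <= shell t.
Proof. by rewrite !mulr_ge0// ramp_ge0. Qed.

Lemma bump_ge0 t : 0 <= bump t. Proof. exact: sqr_ge0. Qed.

Lemma bump_core_le0 t : a < b -> b <= t -> bump_core t <= 0.
Proof.
move=> ab bt; rewrite /bump_core ramp_id; last by lra.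
by rewrite subr_le0 ler_pXn2r ?nnegrE//; lra.
Qed.

Lemma bump_core_gt0 t : a <= t -> t < b -> 0 < bump_core t.
Proof.
move=> at_ tb; rewrite /bump_core ramp_id; last by lra.
by rewrite subr_gt0 ltr_pXn2r ?nnegrE//; lra.
Qed.

Lemma bump_out t : a < b -> b <= t -> bump t = 0.
Proof. by move=> ab bt; rewrite /bump ramp_eq0 ?expr0n// bump_core_le0. Qed.

Lemma shell_out t : a < b -> b <= t -> shell t = 0.
Proof.
by move=> ab bt; rewrite /shell ramp_eq0 ?mulr0 ?mul0r// bump_core_le0.
Qed.

Lemma shell_in t : t <= a -> shell t = 0.
Proof. by move=> ta; rewrite /shell (@ramp_eq0 (t - a)) ?mulr0//; lra. Qed.

Lemma shell_gt0 t : a < t -> t < b -> 0 < shell t.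
Proof.
move=> at_ tb; have c0 := bump_core_gt0 (ltW at_) tb.
rewrite /shell (ramp_id (ltW c0)) ramp_id; last by lra.
by rewrite !mulr_gt0//; lra.
Qed.

Lemma bump_gt0 t : a <= t -> t < b -> 0 < bump t.
Proof.
move=> at_ tb; have c0 := bump_core_gt0 at_ tb.
by rewrite /bump ramp_id ?exprn_gt0// ltW.
Qed.

Lemma bump_mono t t' : t <= t' -> bump t' <= bump t.
Proof.
move=> tt'; rewrite /bump ler_pXn2r ?nnegrE ?ramp_ge0//.
have mono s s' : s <= s' -> ramp s <= ramp s'.
  by move=> ss'; rewrite /ramp ge_max le_max ss' /= le_max lexx orbT.
apply: (mono); rewrite /bump_core lerD2l lerN2 ler_pXn2r ?nnegrE ?ramp_ge0//.
by apply: mono; lra.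
Qed.

(** The remaining bounds are explicit only so that the constants of the main
estimate visibly depend on nothing but the dimension.  The arguments of the
profiles will be squared norms of vectors of length at most two, hence the
restriction to values below four. *)

Lemma ramp_shift_le4 t : 0 <= a -> t <= 4 -> ramp (t - a) <= 4.
Proof. by move=> a0 t4; rewrite /ramp ge_max; apply/andP; split; lra. Qed.

Lemma ramp_core_le1 t : 0 <= a -> a < b -> b <= 1 -> ramp (bump_core t) <= 1.
Proof.
move=> a0 ab b1; rewrite /ramp ge_max ler01 andbT /bump_core.
have : (b - a) ^+ 2 <= 1 by rewrite expr_le1//; lra.
have := sqr_ge0 (ramp (t - a)); lra.
Qed.

Lemma bump_le1 t : 0 <= a -> a < b -> b <= 1 -> bump t <= 1.
Proof. by move=> a0 ab b1; rewrite /bump expr_le1 ?ramp_core_le1 ?ramp_ge0. Qed.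

Lemma shell_le t : 0 <= a -> a < b -> b <= 1 -> shell t <= 8.
Proof.
move=> a0 ab b1; have [bt|tb] := leP b t; first by rewrite shell_out.
have h1 := ramp_core_le1 t a0 ab b1; have h2 := ramp_ge0 (bump_core t).
have h3 : ramp (t - a) <= 1 by rewrite /ramp ge_max; apply/andP; split; lra.
by have h4 := ramp_ge0 (t - a); rewrite /shell; nra.
Qed.

Lemma ramp_core_lip s t : 0 <= a -> s <= 4 -> t <= 4 ->
  `|ramp (bump_core s) - ramp (bump_core t)| <= 8 * `|s - t|.
Proof.
move=> a0 s4 t4; apply: le_trans (ramp_lip _ _) _; rewrite /bump_core.
rewrite (_ : _ - _ = - ((ramp (s - a) - ramp (t - a)) *
  (ramp (s - a) + ramp (t - a)))); last by ring.
rewrite normrN normrM mulrC; apply: ler_pM => //.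
  have h1 := ramp_ge0 (s - a); have h2 := ramp_ge0 (t - a).
  have h3 := ramp_shift_le4 a0 s4; have h4 := ramp_shift_le4 a0 t4.
  by rewrite ger0_norm ?addr_ge0//; lra.
by apply: le_trans (ramp_lip _ _) _; rewrite (_ : s - a - (t - a) = s - t)//; ring.
Qed.

Lemma bump_lip s t : 0 <= a -> a < b -> b <= 1 -> s <= 4 -> t <= 4 ->
  `|bump s - bump t| <= 16 * `|s - t|.
Proof.
move=> a0 ab b1 s4 t4; rewrite /bump subr_sqr normrM.
have := ramp_core_lip a0 s4 t4.
have h1 := ramp_ge0 (bump_core s); have h2 := ramp_ge0 (bump_core t).
have h3 := ramp_core_le1 s a0 ab b1; have h4 := ramp_core_le1 t a0 ab b1.
rewrite (ger0_norm (addr_ge0 h1 h2)).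
have := normr_ge0 (ramp (bump_core s) - ramp (bump_core t)).
have := normr_ge0 (s - t); nra.
Qed.

Lemma shell_lip s t : 0 <= a -> a < b -> b <= 1 -> s <= 4 -> t <= 4 ->
  `|shell s - shell t| <= 264 * `|s - t|.
Proof.
move=> a0 ab b1 s4 t4; rewrite /shell.
rewrite (_ : _ - _ = 8 * ((ramp (bump_core s) - ramp (bump_core t)) * ramp (s - a) +
   ramp (bump_core t) * (ramp (s - a) - ramp (t - a)))); last by ring.
rewrite normrM ger0_norm// (_ : 264 = 8 * 33); last by ring.
rewrite -mulrA ler_pM2l//; apply: le_trans (ler_normD _ _) _.
rewrite !normrM (ger0_norm (ramp_ge0 _)) (ger0_norm (ramp_ge0 (bump_core t))).
have h1 := ramp_core_lip a0 s4 t4; have h2 := ramp_shift_le4 a0 s4.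
have h3 := ramp_ge0 (s - a).
have h4 : `|ramp (s - a) - ramp (t - a)| <= `|s - t|.
  by apply: le_trans (ramp_lip _ _) _; rewrite (_ : s - a - (t - a) = s - t)//; ring.
have h5 := ramp_core_le1 t a0 ab b1; have h6 := ramp_ge0 (bump_core t).
have h7 := normr_ge0 (ramp (s - a) - ramp (t - a)).
have h8 := normr_ge0 (ramp (bump_core s) - ramp (bump_core t)).
have h9 : `|ramp (bump_core s) - ramp (bump_core t)| * ramp (s - a) <=
    (8 * `|s - t|) * 4 by apply: ler_pM.
have h10 : ramp (bump_core t) * `|ramp (s - a) - ramp (t - a)| <= 1 * `|s - t|.
  by apply: ler_pM.
lra.
Qed.

End Profile.

(** * Test functions *)

Section TestFunctions.
Context {R : realType} {n : nat}.
Implicit Types (x y z : 'rV[R]_n) (F : 'rV[R]_n -> R).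

Lemma sqn_line z i (h : R) :
  sqn (z + h *: delta_mx 0 i) = sqn z + (2 * z 0 i) * h + h ^+ 2.
Proof.
rewrite /sqn !(bigD1 i (P := xpredT))//=.
rewrite (eq_bigr (fun j => z 0 j ^+ 2)); last first.
  by move=> j ji; rewrite !mxE (negbTE ji) andbF mulr0 addr0.
by rewrite !mxE !eqxx mulr1; ring.
Qed.

Lemma is_derive_bump_sqn (a b : R) z i :
  is_derive z (delta_mx 0 i) (fun z => bump a b (sqn z))
    (- (z 0 i * shell a b (sqn z))).
Proof.
apply/is_derive_lineP.
have -> : (fun h : R => bump a b (sqn (z + h *: delta_mx 0 i))) =
  bump a b \o (fun h => sqn z + (2 * z 0 i) * h + h ^+ 2).
  by apply/funext => h /=; rewrite sqn_line.
have H : is_derive (0 : R) 1 (fun h => sqn z + (2 * z 0 i) * h + h ^+ 2) (2 * z 0 i).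
  have := is_deriveD (is_deriveD (is_derive_cst (sqn z) (0 : R) 1)
    (is_deriveZ (2 * z 0 i) (is_derive_id (0 : R) 1)))
    (is_deriveX 2 (is_derive_id (0 : R) 1)).
  by rewrite add0r [(2 * z 0 i) *: 1]mulr1 /= expr1 mulr0 scale0r addr0.
have E : sqn z + (2 * z 0 i) * 0 + 0 ^+ 2 = sqn z by rewrite mulr0 expr0n !addr0.
have := is_derive1_comp (is_derive_bump a b _) H.
rewrite E (_ : - (shell a b (sqn z) / 2) * _ = - (z 0 i * shell a b (sqn z)))//.
by field.
Qed.

(** The partial derivatives are part of the data, and one constant [K] bounds the
function and its derivatives: this is the norm of a test function for which
all estimates below are linear. *)
Record testfun (S : set 'rV[R]_n) (K : R) (zeta : 'rV[R]_n -> R)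
    (dzeta : 'I_n -> 'rV[R]_n -> R) : Prop := Testfun {
  tf_closed : closed S ;
  tf_bounded : exists r, S `<=` [set z | `|z| < r] ;
  tf_borel : borel zeta ;
  tf_dborel : forall i, borel (dzeta i) ;
  tf_le : forall z, `|zeta z| <= K ;
  tf_dle : forall i z, `|dzeta i z| <= K ;
  tf_out : forall z, ~ S z -> zeta z = 0 ;
  tf_dout : forall i z, ~ S z -> dzeta i z = 0 ;
  tf_derive : forall i z, is_derive z (delta_mx 0 i) zeta (dzeta i z) }.

Lemma measurable_closed (S : set 'rV[R]_n) : closed S ->
  measurable (vec_of_tuple @^-1` S : set (n.-tuple (measurableTypeR R))).
Proof.
move=> cS; rewrite -[S]setCK -preimage_setC; apply: measurableC.
by apply: measurable_vec_open; exact: closed_openC.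
Qed.

Lemma testfun_tame S K zeta dzeta : testfun S K zeta dzeta -> tame zeta.
Proof.
case=> _ [r Sr] mz _ zK _ z0 _ _; split => //; first by exists K.
exists r => z zz; apply: Sr; apply: contrapT => /z0 zz0.
by rewrite zz0 eqxx in zz.
Qed.

Lemma testfun_dtame S K zeta dzeta i : testfun S K zeta dzeta -> tame (dzeta i).
Proof.
case=> _ [r Sr] _ mz _ zK _ z0 _; split => //; first by exists K.
exists r => z zz; apply: Sr; apply: contrapT => /z0 zz0.
by rewrite zz0 eqxx in zz.
Qed.

Lemma testfun_tame_indic S K zeta dzeta : testfun S K zeta dzeta ->
  tame (\1_S : 'rV[R]_n -> R).
Proof.
case=> cS [r Sr] _ _ _ _ _ _ _; apply: tame_indic Sr; exact: measurable_closed.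
Qed.

Lemma borel_ramp F : borel F -> borel (fun x => ramp (F x)).
Proof. by move=> mF; apply: measurable_maxr => //; exact: borel_cst. Qed.

Lemma borel_sqrt F : borel F -> borel (fun x => Num.sqrt (F x)).
Proof.
move=> mF; have ms : measurable_fun setT (@Num.sqrt R : measurableTypeR R -> _).
  by apply: continuous_measurable_fun; exact: sqrt_continuous.
exact: (measurableT_comp ms mF).
Qed.

Lemma borelX F k : borel F -> borel (fun x => F x ^+ k).
Proof.
move=> mF; elim: k => [|k IH].
  rewrite (_ : (fun _ => _) = (fun=> 1)); first exact: borel_cst.
  by apply/funext => x; rewrite expr0.
rewrite (_ : (fun _ => _) = (fun x => F x * F x ^+ k)); first exact: borelM.
by apply/funext => x; rewrite exprS.
Qed.

Lemma borel_bump_core (a b : R) F : borel F -> borel (fun x => bump_core a b (F x)).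
Proof.
move=> mF; apply: borelB; first exact: borel_cst.
by apply: borelX; apply: borel_ramp; apply: borelB mF (borel_cst _).
Qed.

Lemma borel_bump (a b : R) F : borel F -> borel (fun x => bump a b (F x)).
Proof. by move=> mF; apply: borelX; apply: borel_ramp; exact: borel_bump_core. Qed.

Lemma borel_shell (a b : R) F : borel F -> borel (fun x => shell a b (F x)).
Proof.
move=> mF; apply: borelM.
  by apply: borelM; [exact: borel_cst|apply: borel_ramp; exact: borel_bump_core].
by apply: borel_ramp; apply: borelB mF (borel_cst _).
Qed.

Lemma bump_testfun (a b r : R) : 0 <= a -> a < b -> b <= 1 -> 0 <= r -> b <= r ^+ 2 ->
  testfun (@eclosed_ball R n r) 8 (fun z => bump a b (sqn z))
    (fun i z => - (z 0 i * shell a b (sqn z))).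
Proof.
move=> a0 ab b1 r0 br.
have out z : ~ @eclosed_ball R n r z -> b <= sqn z.
  rewrite /eclosed_ball /= => /negP; rewrite -ltNge => rz.
  by rewrite -enorm_sqr (le_trans br)// ler_pXn2r ?nnegrE ?enorm_ge0// ltW.
split.
- exact: closed_eclosed_ball.
- exists (r + 1) => z /= zr; apply: le_lt_trans (norm_le_enorm z) _.
  by apply: le_lt_trans zr _; rewrite ltrDl.
- by apply: borel_bump; exact: borel_sqn.
- move=> i; apply: borelN; apply: borelM; first exact: borel_coord.
  by apply: borel_shell; exact: borel_sqn.
- move=> z; rewrite ger0_norm ?bump_ge0//.
  by apply: le_trans (bump_le1 _ a0 ab b1) _; rewrite ler1n.
- move=> i z; rewrite normrN normrM (ger0_norm (shell_ge0 _ _ _)).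
  have [bz|zb] := leP b (sqn z); first by rewrite (shell_out ab bz) mulr0.
  rewrite -(mul1r 8); apply: ler_pM => //; first exact: shell_ge0.
    rewrite -(expr_le1 (n := 2))// real_normK ?num_real//.
    apply: le_trans (le_trans (ltW zb) b1).
    rewrite -enorm_sqr -real_normK ?num_real// ler_pXn2r ?nnegrE ?enorm_ge0//.
    exact: coord_le_enorm.
  exact: shell_le a0 ab b1.
- by move=> z /out; exact: bump_out ab.
- by move=> i z /out bz; rewrite (shell_out ab bz) mulr0 oppr0.
- by move=> i z; exact: is_derive_bump_sqn.
Qed.

End TestFunctions.

(** * Functions restricted to the unit ball *)

Section RestrictBall.
Context {R : realType} {n : nat}.
Implicit Types (x y z : 'rV[R]_n) (F : 'rV[R]_n -> R).

(** The data of the problem are arbitrary outside the ball; extending by zero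
makes them tame functions on the whole space. *)
Definition on_ball F : 'rV[R]_n -> R := F \_ (eball 1).

Lemma on_ballE F x : eball 1 x -> on_ball F x = F x.
Proof. by move=> Bx; rewrite /on_ball patchT// inE. Qed.

Lemma on_ball_out F x : ~ eball 1 x -> on_ball F x = 0.
Proof. by move=> Bx; rewrite /on_ball patchN//; apply/negP; rewrite inE. Qed.

Lemma nbhs_eball x (r : R) : eball r x -> nbhs x (@eball R n r).
Proof. by move=> Bx; apply: open_nbhs_nbhs; split => //; exact: open_eball. Qed.

Lemma is_derive_on_ball F y v d : eball 1 y -> is_derive y v F d ->
  is_derive y v (on_ball F) d.
Proof.
move=> By; apply: near_eq_is_derive.
by apply: filterS (nbhs_eball By) => x Bx; rewrite on_ballE.
Qed.

Lemma tame_on_ball F : (forall x, eball 1 x -> {for x, continuous F}) ->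
  (exists M, forall x, eball 1 x -> `|F x| <= M) -> tame (on_ball F).
Proof.
move=> cF [M FM]; split.
- by apply: borel_continuous_on => //; exact: open_eball.
- exists (Num.max M 0) => x; rewrite le_max.
  have [Bx|Bx] := pselect (eball 1 x); first by rewrite on_ballE// FM.
  by rewrite on_ball_out// normr0 lexx orbT.
- exists 1 => x; have [Bx _|Bx] := pselect (eball 1 x).
    exact: le_lt_trans (norm_le_enorm x) Bx.
  by rewrite on_ball_out// eqxx.
Qed.

Lemma within_bounded (g : 'rV[R]_n -> R) : {within eclosed_ball 1, continuous g} ->
  exists M, forall x, eclosed_ball 1 x -> `|g x| <= M.
Proof.
move=> cg.
have /compact_bounded [M [_ HM]] := continuous_compact cg (@compact_eclosed_ball R n 1).
by exists (M + 1) => x Bx; apply: (HM (M + 1)); [rewrite ltrDl|exists x].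
Qed.

Lemma smooth_differentiable F s x : smooth_closed_ball F -> eball 1 x ->
  differentiable (iter_partial s F) x.
Proof. by move=> [_ /(_ s) [H _]] /H. Qed.

Lemma smooth_tame F s : smooth_closed_ball F -> tame (on_ball (iter_partial s F)).
Proof.
move=> sF; apply: tame_on_ball => [x Bx|].
  by apply: differentiable_continuous; exact: smooth_differentiable.
have [_ /(_ s) [_ [g /within_bounded [M gM] gF]]] := sF.
by exists M => x Bx; rewrite -gF// gM// /eclosed_ball /= ltW.
Qed.

Lemma is_derive_sumE (I : Type) (r : seq I) (h : I -> 'rV[R]_n -> R) (dh : I -> R) x v :
  (forall i, is_derive x v (h i) (dh i)) ->
  is_derive x v (fun x => \sum_(i <- r) h i x) (\sum_(i <- r) dh i).
Proof.
move=> H; elim: r => [|i r IH].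
  rewrite big_nil (_ : (fun _ => _) = cst 0); first exact: is_derive_cst.
  by apply/funext => y; rewrite big_nil.
rewrite big_cons (_ : (fun _ => _) = h i + (fun x => \sum_(i <- r) h i x)).
  exact: is_deriveD.
by apply/funext => y; rewrite big_cons.
Qed.

Lemma is_derive_mulE (f g : 'rV[R]_n -> R) df dg x v :
  is_derive x v f df -> is_derive x v g dg ->
  is_derive x v (fun x => f x * g x) (df * g x + f x * dg).
Proof.
move=> Hf Hg; have := is_deriveM Hf Hg.
by rewrite addrC [g x *: df]mulrC.
Qed.

End RestrictBall.

(** * Weak form of the equation *)

Section Duality.
Context {R : realType} {n : nat}.
Context (A : 'rV[R]_n -> 'M[R]_n) (b : 'rV[R]_n -> 'rV[R]_n) (u : 'rV[R]_n -> R).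
Hypothesis (sA : forall i j, smooth_closed_ball (fun x => A x i j)).
Hypothesis (sb : forall i, smooth_closed_ball (fun x => b x 0 i)).
Hypothesis (su : smooth_closed_ball u).
Implicit Types (x y z : 'rV[R]_n).

Let ua j := on_ball (partial j u).
Let aa i j := on_ball (fun y => A y i j).
Let da i j := on_ball (partial i (fun y => A y i j)).
Let ba j := on_ball (fun y => b y 0 j).
Let uu i j := on_ball (partial i (partial j u)).

(** Nonnegative exactly because [u] is a supersolution. *)
Definition defect := on_ball (fun x => - operator A b u x).

Let bua j : tame (ua j). Proof. exact: (smooth_tame [:: j] su). Qed.
Let baa i j : tame (aa i j). Proof. exact: (smooth_tame [::] (sA i j)). Qed.
Let bda i j : tame (da i j). Proof. exact: (smooth_tame [:: i] (sA i j)). Qed.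
Let bba j : tame (ba j). Proof. exact: (smooth_tame [::] (sb j)). Qed.
Let buu i j : tame (uu i j). Proof. exact: (smooth_tame [:: i; j] su). Qed.

Lemma defectE : defect = fun x => - (\sum_i \sum_j aa i j x * uu i j x + \sum_j ba j x * ua j x).
Proof.
apply/funext => x; have [Bx|Bx] := pselect (eball 1 x).
  rewrite /defect on_ballE// /operator; congr (- (_ + _)).
    apply: eq_bigr => i _; apply: eq_bigr => j _.
    by rewrite /aa /uu !on_ballE.
  by apply: eq_bigr => j _; rewrite /ba /ua !on_ballE.
rewrite /defect on_ball_out// big1 => [|i _]; last first.
  by rewrite big1// => j _; rewrite /aa on_ball_out// mul0r.
by rewrite big1 ?addr0 ?oppr0// => j _; rewrite /ba on_ball_out// mul0r.
Qed.

Lemma tame_defect : tame defect.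
Proof.
rewrite defectE; apply: tameN; apply: tameD.
  apply: tame_sum => i; apply: tame_sum => j.
  by apply: tameM => //; [exact: tame_borel|exact: tame_bounded].
by apply: tame_sum => j; apply: tameM => //; [exact: tame_borel|exact: tame_bounded].
Qed.

Definition lower_order y :=
  \sum_j ba j y * ua j y - \sum_i \sum_j da i j y * ua j y.

Lemma tame_lower_order : tame lower_order.
Proof.
apply: tameB.
  by apply: tame_sum => j; apply: tameM => //; [exact: tame_borel|exact: tame_bounded].
apply: tame_sum => i; apply: tame_sum => j.
by apply: tameM => //; [exact: tame_borel|exact: tame_bounded].
Qed.

Definition flux i y := \sum_j aa i j y * ua j y.

Lemma tame_flux i : tame (flux i).
Proof.
apply: tame_sum => j.
by apply: tameM => //; [exact: tame_borel|exact: tame_bounded].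
Qed.

Let dflux i y := \sum_j (da i j y * ua j y + aa i j y * uu i j y).

Let tame_dflux i : tame (dflux i).
Proof.
apply: tame_sum => j; apply: tameD;
by apply: tameM => //; [exact: tame_borel|exact: tame_bounded].
Qed.

Let is_derive_flux i y : eball 1 y ->
  is_derive y (delta_mx 0 i) (flux i) (dflux i y).
Proof.
move=> By; apply: is_derive_sumE => j.
apply: is_derive_mulE; rewrite /da /uu on_ballE//; apply: is_derive_on_ball => //.
  split=> //; apply: diff_derivable; exact: (smooth_differentiable [::] (sA i j)).
split=> //; apply: diff_derivable; exact: (smooth_differentiable [:: j] su).
Qed.

Let sum_dflux y : \sum_i dflux i y = - (defect y + lower_order y).
Proof.
rewrite defectE /lower_order /dflux (eq_bigr (fun i =>
  \sum_j da i j y * ua j y + \sum_j aa i j y * uu i j y)); last first.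
  by move=> i _; rewrite big_split.
by rewrite big_split/=; ring.
Qed.

(** The integrals of the derivatives of [zeta z * flux i (x + s z)] vanish.  The
variable of integration is [z] rather than [x + s z], so no change of variables
enters and the identity remains meaningful down to [s = 0]. *)
Lemma duality S K zeta dzeta x (s : R) : testfun S K zeta dzeta ->
  (forall z, S z -> eball 1 (x + s *: z)) ->
  intRn (fun z => \sum_i dzeta i z * flux i (x + s *: z)) =
  s * intRn (fun z => zeta z * (defect (x + s *: z) + lower_order (x + s *: z))).
Proof.
move=> tf SB.
have bz := testfun_tame tf; have bdz i := testfun_dtame i tf.
have shb F : tame F -> forall G, tame G -> tame (fun z => G z * F (x + s *: z)).
  move=> bF G bG; apply: tameM => //; first exact: (borel_shift x s (tame_borel bF)).
  by have [M FM] := tame_bounded bF; exists M => z; exact: FM.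
pose g i z := dzeta i z * flux i (x + s *: z) + zeta z * (s * dflux i (x + s *: z)).
have bg i : tame (g i).
  apply: tameD; first by apply: (shb (flux i)) => //; exact: tame_flux.
  rewrite (_ : (fun _ => _) = fun z => s * (zeta z * dflux i (x + s *: z))).
    by apply: tameZ; apply: shb.
  by apply/funext => z; ring.
have Ig i : intRn (g i) = 0.
  have [M gM] := tame_bounded (bg i).
  apply: (@intRn_derive_eq0 _ _ (fun z => zeta z * flux i (x + s *: z)) _
    (delta_mx 0 i) M) => //.
  - by apply: (shb (flux i)) => //; exact: tame_flux.
  - exact: tame_borel.
  - move=> z; have [Bz|Bz] := pselect (eball 1 (x + s *: z)).
      apply: is_derive_mulE; first exact: tf_derive tf _ _.
      exact/is_derive_affine/is_derive_flux.
    have Sz : ~ S z by move=> /SB.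
    rewrite /g (tf_out tf Sz) (tf_dout tf _ Sz) !mul0r addr0.
    apply: (@near_eq_is_derive _ _ _ (cst 0)).
    have : nbhs z (~` S).
      apply: open_nbhs_nbhs; split => //.
      by apply: closed_openC; exact: tf_closed tf.
    by apply: filterS => z' Sz'; rewrite (tf_out tf Sz') mul0r.
have : intRn (fun z => \sum_i g i z) = 0.
  by rewrite intRn_sum// big1.
have -> : (fun z => \sum_i g i z) = (fun z =>
   \sum_i dzeta i z * flux i (x + s *: z) -
     s * (zeta z * (defect (x + s *: z) + lower_order (x + s *: z)))).
  apply/funext => z; rewrite big_split/= -mulr_sumr -mulr_sumr sum_dflux.
  by ring.
rewrite intRnB.
- rewrite intRnZ => [/eqP|]; first by rewrite subr_eq0 => /eqP.
  by apply: (shb (fun y => defect y + lower_order y)) => //;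
    apply: tameD; [exact: tame_defect|exact: tame_lower_order].
- by apply: tame_sum => i; apply: (shb (flux i)) => //; exact: tame_flux.
- apply: tameZ; apply: (shb (fun y => defect y + lower_order y)) => //.
  by apply: tameD; [exact: tame_defect|exact: tame_lower_order].
Qed.

End Duality.

(** * Mass of the source *)

Section Estimates.
Context {R : realType} {n : nat}.
Context (A : 'rV[R]_n -> 'M[R]_n) (b : 'rV[R]_n -> 'rV[R]_n) (u : 'rV[R]_n -> R).
Context (eps : R).
Hypothesis (sA : forall i j, smooth_closed_ball (fun x => A x i j)).
Hypothesis (sb : forall i, smooth_closed_ball (fun x => b x 0 i)).
Hypothesis (su : smooth_closed_ball u).
Hypothesis (eps0 : 0 <= eps).
Hypothesis (Lu : forall x, eball 1 x -> operator A b u x <= 0).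
Hypothesis (A_I : forall x i j, eball 1 x -> `|A x i j - (i == j)%:R| <= n%:R * eps).
Hypothesis (A_D : forall x i j k, eball 1 x ->
  `|partial k (fun y => A y i j) x| <= eps).
Hypothesis (b_le : forall x i, eball 1 x -> `|b x 0 i| <= eps).
Implicit Types (x y z : 'rV[R]_n).

Local Notation ua j := (on_ball (partial j u)).
Local Notation defect := (defect A b u).
Local Notation lower_order := (lower_order A b u).
Local Notation flux := (flux A u).

Definition gradnorm : 'rV[R]_n -> R := on_ball (fun y => enorm (grad u y)).

Definition dim_const : R := n%:R + n%:R ^+ 2 + n%:R ^+ 3.

(** The second term absorbs the deviation of the leading coefficients from the
identity, their derivatives and the drift. *)
Definition source y : R := defect y + dim_const * eps * gradnorm y.

Let bua j : tame (ua j). Proof. exact: (smooth_tame [:: j] su). Qed.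

Lemma gradnorm_ge0 y : 0 <= gradnorm y.
Proof.
have [By|By] := pselect (eball 1 y); last by rewrite /gradnorm on_ball_out.
by rewrite /gradnorm on_ballE// enorm_ge0.
Qed.

Lemma partial_le_gradnorm j y : `|ua j y| <= gradnorm y.
Proof.
have [By|By] := pselect (eball 1 y); last by rewrite /gradnorm !on_ball_out// normr0.
rewrite /gradnorm !on_ballE//; have := coord_le_enorm (grad u y) j.
by rewrite mxE.
Qed.

Lemma tame_gradnorm : tame gradnorm.
Proof.
have E : gradnorm = fun y => Num.sqrt (\sum_j ua j y ^+ 2).
  apply/funext => y; have [By|By] := pselect (eball 1 y).
    rewrite /gradnorm on_ballE// /enorm; congr Num.sqrt; apply: eq_bigr => j _.
    by rewrite mxE on_ballE.
  rewrite /gradnorm on_ball_out// big1 ?sqrtr0// => j _.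
  by rewrite on_ball_out// expr0n.
apply: (@tame_le _ _ _ (fun y => \sum_j `|ua j y|)).
- rewrite E; apply: borel_sqrt.
  by apply: borel_sum => j; apply: borelX; apply: tame_borel.
- by apply: tame_sum => j; exact: tame_norm.
- move=> y; rewrite ger0_norm ?gradnorm_ge0// [leRHS]ger0_norm; last exact: sumr_ge0.
  have [By|By] := pselect (eball 1 y); last by rewrite /gradnorm on_ball_out// sumr_ge0.
  rewrite /gradnorm on_ballE//; apply: le_trans (enorm_le_sum _) _.
  by apply: ler_sum => j _; rewrite mxE on_ballE.
Qed.

Lemma defect_ge0 y : 0 <= defect y.
Proof.
have [By|By] := pselect (eball 1 y); last by rewrite /defect on_ball_out.
by rewrite /defect on_ballE// oppr_ge0 Lu.
Qed.

Lemma dim_const_ge0 : 0 <= dim_const.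
Proof. by rewrite /dim_const !addr_ge0// exprn_ge0. Qed.

Lemma source_ge0 y : 0 <= source y.
Proof. by rewrite addr_ge0 ?defect_ge0// !mulr_ge0 ?dim_const_ge0 ?gradnorm_ge0. Qed.

Lemma tame_source : tame source.
Proof. by apply: tameD; [exact: tame_defect|apply: tameZ; exact: tame_gradnorm]. Qed.

Lemma lower_order_le y : `|lower_order y| <= (n%:R + n%:R ^+ 2) * eps * gradnorm y.
Proof.
have [By|By] := pselect (eball 1 y); last first.
  rewrite /lower_order big1 => [|j _]; last by rewrite on_ball_out// mul0r.
  rewrite big1 => [|j _]; last by rewrite big1// => i _; rewrite on_ball_out// mul0r.
  by rewrite subrr normr0 !mulr_ge0 ?gradnorm_ge0// addr_ge0// exprn_ge0.
rewrite /lower_order !mulrDl; apply: le_trans (ler_normB _ _) _.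
have P k : eps * gradnorm y *+ k = k%:R * eps * gradnorm y.
  by rewrite -mulr_natl mulrA.
apply: lerD; apply: le_trans (ler_norm_sum _ _ _) _.
  rewrite -P -[X in _ *+ X](card_ord n) -sumr_const.
  apply: ler_sum => j _; rewrite normrM; apply: ler_pM => //; last exact: partial_le_gradnorm.
  by rewrite on_ballE// b_le.
rewrite expr2 -natrM -P mulrnA -[X in _ *+ _ *+ X](card_ord n) -sumr_const.
apply: ler_sum => i _; apply: le_trans (ler_norm_sum _ _ _) _.
rewrite -[X in _ *+ X](card_ord n) -sumr_const.
apply: ler_sum => j _; rewrite normrM; apply: ler_pM => //; last exact: partial_le_gradnorm.
by rewrite on_ballE// A_D.
Qed.

Lemma flux_partial_le i y : `|flux i y - ua i y| <= n%:R ^+ 2 * eps * gradnorm y.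
Proof.
have [By|By] := pselect (eball 1 y); last first.
  rewrite /flux big1 => [|j _]; last by rewrite on_ball_out// mul0r.
  by rewrite on_ball_out// subrr normr0 !mulr_ge0 ?gradnorm_ge0// exprn_ge0.
have -> : flux i y - ua i y = \sum_j (A y i j - (i == j)%:R) * ua j y.
  rewrite (eq_bigr (fun j => A y i j * ua j y - (i == j)%:R * ua j y)); last first.
    by move=> j _; rewrite mulrBl.
  rewrite sumrB; congr (_ - _).
    by apply: eq_bigr => j _; rewrite !on_ballE.
  rewrite (bigD1 i)//= eqxx mul1r big1 ?addr0// => j ji.
  by rewrite eq_sym (negbTE ji) mul0r.
apply: le_trans (ler_norm_sum _ _ _) _.
have -> : n%:R ^+ 2 * eps * gradnorm y = (n%:R * eps * gradnorm y) *+ n.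
  by rewrite -[RHS]mulr_natl; ring.
rewrite -[X in _ *+ X](card_ord n) -sumr_const.
apply: ler_sum => j _; rewrite normrM; apply: ler_pM => //; last exact: partial_le_gradnorm.
exact: A_I.
Qed.

(** What is lost when [L] is replaced by the Laplacian in its weak form. *)
Lemma remainder_le K (zeta : R) (dzeta : 'I_n -> R) y :
  `|zeta| <= K -> (forall i, `|dzeta i| <= K) ->
  `|zeta * lower_order y| + `|\sum_i dzeta i * (flux i y - ua i y)|
    <= K * (dim_const * eps * gradnorm y).
Proof.
move=> zK dzK; have K0 : 0 <= K by apply: le_trans zK.
rewrite [leRHS](_ : _ = K * ((n%:R + n%:R ^+ 2) * eps * gradnorm y) +
  (K * (n%:R ^+ 2 * eps * gradnorm y)) *+ n); last first.
  by rewrite -[X in _ = _ + X]mulr_natl /dim_const; ring.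
apply: lerD.
  by rewrite normrM; apply: ler_pM => //; exact: lower_order_le.
apply: le_trans (ler_norm_sum _ _ _) _.
rewrite -[X in _ *+ X](card_ord n) -sumr_const.
apply: ler_sum => j _; rewrite normrM; apply: ler_pM => //.
exact: flux_partial_le.
Qed.

Lemma tame_shiftM (G F : 'rV[R]_n -> R) x (s : R) : tame G -> tame F ->
  tame (fun z => G z * F (x + s *: z)).
Proof.
move=> bG bF; apply: tameM => //; first exact: (borel_shift x s (tame_borel bF)).
by have [M FM] := tame_bounded bF; exists M => z; exact: FM.
Qed.

(** The sense in which [source] dominates the Laplacian of [u]. *)
Lemma dual_bound S K zeta dzeta x (s : R) : testfun S K zeta dzeta ->
  0 <= s <= 1 -> (forall z, S z -> eball 1 (x + s *: z)) ->
  `|intRn (fun z => \sum_i dzeta i z * ua i (x + s *: z))| <=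
  K * intRn (fun z => \1_S z * source (x + s *: z)).
Proof.
move=> tf /andP[s0 s1] SB.
have bz := testfun_tame tf; have bdz i := testfun_dtame i tf.
have b1 : tame (fun z => s * (zeta z * (defect (x + s *: z) + lower_order (x + s *: z)))).
  apply: tameZ; apply: (tame_shiftM (F := fun y => defect y + lower_order y)) => //.
  by apply: tameD; [exact: tame_defect|exact: tame_lower_order].
have b2 : tame (fun z => \sum_i dzeta i z * flux i (x + s *: z)).
  by apply: tame_sum => i; apply: tame_shiftM => //; exact: tame_flux.
have b3 : tame (fun z => \sum_i dzeta i z * ua i (x + s *: z)).
  by apply: tame_sum => i; apply: tame_shiftM.
have bS := testfun_tame_indic tf.
have b4 : tame (fun z => \1_S z * source (x + s *: z)).
  by apply: tame_shiftM => //; exact: tame_source.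
have -> : intRn (fun z => \sum_i dzeta i z * ua i (x + s *: z)) =
  intRn (fun z => s * (zeta z * (defect (x + s *: z) + lower_order (x + s *: z))) -
    (\sum_i dzeta i z * flux i (x + s *: z) -
     \sum_i dzeta i z * ua i (x + s *: z))).
  rewrite intRnB ?intRnB//; last exact: tameB.
  rewrite intRnZ; last first.
    apply: (tame_shiftM (F := fun y => defect y + lower_order y)) => //.
    by apply: tameD; [exact: tame_defect|exact: tame_lower_order].
  by rewrite -(duality sA sb su tf SB); ring.
rewrite -intRnZ//; apply: normr_intRn_le; [|exact: tameZ|].
  by apply: tameB => //; exact: tameB.
move=> z; rewrite indicE; set y := x + s *: z.
have [Sz|Sz] := pselect (S z); last first.
  rewrite memNset// mul0r mulr0 (tf_out tf Sz) mul0r mulr0 sub0r.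
  rewrite big1 => [|i _]; last by rewrite (tf_dout tf _ Sz) mul0r.
  by rewrite big1 ?subrr ?oppr0 ?normr0// => i _; rewrite (tf_dout tf _ Sz) mul0r.
rewrite mem_set// mul1r -sumrB.
rewrite (eq_bigr (fun i => dzeta i z * (flux i y - ua i y))); last first.
  by move=> i _; rewrite mulrBr.
have rem := remainder_le y (tf_le tf z) (fun i => tf_dle tf i z).
have muK : `|zeta z * defect y| <= K * defect y.
  rewrite normrM (ger0_norm (defect_ge0 y)); apply: ler_wpM2r; first exact: defect_ge0.
  exact: tf_le tf z.
rewrite /source [leRHS]mulrDr; apply: le_trans (ler_normB _ _) _.
apply: le_trans _ (lerD muK rem).
rewrite (addrA `|zeta z * defect y|); apply: lerD => //.
rewrite normrM (ger0_norm s0); apply: (@le_trans _ _ `|zeta z * (defect y + lower_order y)|).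
  by rewrite ler_piMl.
by rewrite mulrDr ler_normD.
Qed.

Definition annulus : set 'rV[R]_n := eball 1 `\` eball (1 / 8).

(** The integrand [|y . grad u|], which on the unit ball is at most the absolute
value of the radial derivative. *)
Definition radial_slope y : R := \1_annulus y * `|\sum_i y 0 i * ua i y|.

Lemma measurable_eball (r : R) :
  measurable (vec_of_tuple @^-1` (@eball R n r) : set (n.-tuple (measurableTypeR R))).
Proof. by apply: measurable_vec_open; exact: open_eball. Qed.

Lemma measurable_annulus :
  measurable (vec_of_tuple @^-1` annulus : set (n.-tuple (measurableTypeR R))).
Proof.
rewrite /annulus -[X in measurable X]/((vec_of_tuple @^-1` eball 1) `\`
  (vec_of_tuple @^-1` eball (1/8))).
by apply: measurableD; exact: measurable_eball.
Qed.

Lemma tame_indic_annulus : tame (\1_annulus : 'rV[R]_n -> R).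
Proof.
apply: (tame_indic (r := 1)); first exact: measurable_annulus.
by move=> x [Bx _] /=; apply: le_lt_trans (norm_le_enorm x) Bx.
Qed.

Lemma tame_dot : tame (fun y => \sum_i y 0 i * ua i y).
Proof.
apply: tame_sum => i; rewrite (_ : (fun _ => _) = fun y => on_ball (fun y => y 0 i) y * ua i y).
  apply: tameM; [|exact: tame_borel|exact: tame_bounded].
  apply: tame_on_ball => [x _|]; first exact: coord_continuous.
  by exists 1 => y By; apply: le_trans (coord_le_enorm _ _) (ltW By).
apply/funext => y; have [By|By] := pselect (eball 1 y); first by rewrite !on_ballE.
by rewrite !on_ball_out// !mulr0.
Qed.

Lemma tame_radial_slope : tame radial_slope.
Proof.
apply: tameM; first exact: tame_indic_annulus.
  by apply: borel_norm; exact: tame_borel tame_dot.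
have [M HM] := tame_bounded tame_dot.
by exists M => y; rewrite normr_id; exact: HM.
Qed.

Lemma radial_slope_ge0 y : 0 <= radial_slope y.
Proof. by rewrite mulr_ge0// indicE. Qed.

Definition smallness : R := intRn radial_slope + eps * intRn gradnorm.

(** [225/256 = (15/16)^2] and [49/64 = (7/8)^2]: the cut-off of [mass_bound] is
supported in the ball of radius [15/16], and the denominator is its least value
on the ball of radius [7/8]. *)
Definition mass_const : R := (8 + 9 * dim_const) / bump (1 / 64) (225 / 256) (49 / 64).

Lemma mass_bump_gt0 : 0 < bump (1 / 64) (225 / 256) (49 / 64) :> R.
Proof. by apply: bump_gt0; lra. Qed.

Lemma mass_const_ge0 : 0 <= mass_const.
Proof.
rewrite divr_ge0 ?(ltW mass_bump_gt0)//.
by rewrite addr_ge0// mulr_ge0// dim_const_ge0.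
Qed.

Lemma smallness_ge0 : 0 <= smallness.
Proof.
rewrite addr_ge0 ?mulr_ge0// intRn_ge0//.
  exact: radial_slope_ge0.
exact: gradnorm_ge0.
Qed.

(** The cut-off is constant on the ball of radius [1/8], so its gradient,
a multiple of [y], pairs with [grad u] only in the annulus and only through the
radial derivative.  As [defect] is nonnegative, its integral against the
cut-off bounds its mass. *)
Lemma mass_bound :
  intRn (fun y => \1_(@eclosed_ball R n (7 / 8)) y * source y) <= mass_const * smallness.
Proof.
pose a0 : R := 1 / 64; pose b0 : R := 225 / 256.
pose eta z := bump a0 b0 (sqn z).
pose deta (i : 'I_n) z := - (z 0 i * shell a0 b0 (sqn z)).
have h1 : 0 <= a0 by rewrite /a0; lra.
have h2 : a0 < b0 by rewrite /a0 /b0; lra.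
have h3 : b0 <= 1 by rewrite /b0; lra.
have tf : testfun (@eclosed_ball R n (15 / 16)) 8 eta deta.
  apply: (bump_testfun h1 h2 h3); first by lra.
  by rewrite /b0 (_ : 225 / 256 = (15 / 16) ^+ 2)//; field.
have SB z : eclosed_ball (15 / 16) z -> eball 1 (0 + 1 *: z).
  by rewrite add0r scale1r => /le_lt_trans; apply; lra.
have bz := testfun_tame tf; have bdz i := testfun_dtame i tf.
have E z : 0 + 1 *: z = z by rewrite add0r scale1r.
have D : intRn (fun z => \sum_i deta i z * flux i z) =
    intRn (fun z => eta z * (defect z + lower_order z)).
  have := duality sA sb su tf SB; rewrite mul1r => D.
  transitivity (intRn (fun z => \sum_i deta i z * flux i (0 + 1 *: z))).
    by congr intRn; apply/funext => z; rewrite E.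
  by rewrite D; congr intRn; apply/funext => z; rewrite E.
have bM (F G : 'rV[R]_n -> R) : tame F -> tame G -> tame (fun z => F z * G z).
  by move=> bF bG; apply: tameM => //; [exact: tame_borel|exact: tame_bounded].
have bmuz : tame (fun z => eta z * defect z) by apply: bM => //; exact: tame_defect.
have bloz : tame (fun z => eta z * lower_order z).
  by apply: bM => //; exact: tame_lower_order.
have bfl : tame (fun z => \sum_i deta i z * flux i z).
  by apply: tame_sum => i; apply: bM => //; exact: tame_flux.
have bG : tame (fun z => dim_const * eps * gradnorm z) by apply: tameZ; exact: tame_gradnorm.
have Imu : intRn (fun z => eta z * defect z) =
    intRn (fun z => \sum_i deta i z * flux i z - eta z * lower_order z).
  rewrite intRnB// D -intRnB//; last first.
    by apply: bM => //; apply: tameD; [exact: tame_defect|exact: tame_lower_order].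
  by congr intRn; apply/funext => z; rewrite mulrDr addrK.
have pw z : \sum_i deta i z * flux i z - eta z * lower_order z <=
   8 * radial_slope z + 8 * (dim_const * eps * gradnorm z).
  have rem := remainder_le z (tf_le tf z) (fun i => tf_dle tf i z).
  have -> : \sum_i deta i z * flux i z = - (shell a0 b0 (sqn z) * \sum_i z 0 i * ua i z) +
     \sum_i deta i z * (flux i z - ua i z).
    rewrite mulr_sumr -sumrN -big_split/=; apply: eq_bigr => i _.
    by rewrite /deta; ring.
  have key : `|shell a0 b0 (sqn z) * \sum_i z 0 i * ua i z| <= 8 * radial_slope z.
    rewrite normrM (ger0_norm (shell_ge0 _ _ _)) /radial_slope indicE.
    have [Az|Az] := pselect (annulus z).
      by rewrite mem_set// mul1r ler_wpM2r// (shell_le _ h1 h2 h3).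
    rewrite memNset// mul0r mulr0.
    have [Bz|Bz] := pselect (eball 1 z); last first.
      by rewrite big1 ?normr0 ?mulr0// => i _; rewrite on_ball_out// mulr0.
    have : eball (1 / 8) z by apply: contrapT => nz; apply: Az.
    rewrite /eball /= => zlt; rewrite shell_in ?mul0r//.
    rewrite -enorm_sqr /a0 (_ : 1 / 64 = (1 / 8) ^+ 2); last by field.
    by rewrite ler_pXn2r ?nnegrE ?enorm_ge0// ?ltW//; lra.
  move: key rem; rewrite !ler_norml; set P := _ * \sum_i _; set Q := \sum_i _.
  move=> /andP[k1 k2] rem.
  have := ler_norm Q; have := lerNnormlW (lexx `|eta z * lower_order z|).
  lra.
(* the cut-off is radially decreasing *)
have low z : bump a0 b0 (49 / 64) * (\1_(@eclosed_ball R n (7 / 8)) z * source z) <=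
   eta z * defect z + dim_const * eps * gradnorm z.
  have g0 : 0 <= dim_const * eps * gradnorm z by rewrite !mulr_ge0 ?dim_const_ge0 ?gradnorm_ge0.
  have m0 := defect_ge0 z.
  have e0 : 0 <= eta z by exact: bump_ge0.
  rewrite indicE; have [Bz|Bz] := pselect (eclosed_ball (7 / 8) z); last first.
    by rewrite memNset// mul0r mulr0 addr_ge0// mulr_ge0.
  rewrite mem_set// mul1r /source mulrDr; apply: lerD.
    apply: ler_wpM2r => //; apply: bump_mono.
    rewrite -enorm_sqr (_ : 49 / 64 = (7 / 8) ^+ 2); last by field.
    by rewrite ler_pXn2r ?nnegrE ?enorm_ge0//; lra.
  by rewrite ler_piMl// (bump_le1 _ h1 h2 h3).
have bS : tame (\1_(@eclosed_ball R n (7 / 8)) : 'rV[R]_n -> R).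
  apply: (tame_indic (r := 1)).
    by apply: measurable_closed; exact: closed_eclosed_ball.
  by move=> z Bz /=; apply: le_lt_trans (norm_le_enorm z) (le_lt_trans Bz _); lra.
rewrite /mass_const mulrAC ler_pdivlMr ?mass_bump_gt0// mulrC -intRnZ; last first.
  by apply: bM => //; exact: tame_source.
apply: (@le_trans _ _ (intRn (fun z => eta z * defect z + dim_const * eps * gradnorm z))).
  by apply: le_intRn low; [apply: tameZ; apply: bM => //; exact: tame_source|exact: tameD].
rewrite intRnD// Imu -intRnD//; last exact: tameB.
apply: (@le_trans _ _ (intRn (fun z => 8 * radial_slope z + (9 * dim_const * eps) * gradnorm z))).
  apply: le_intRn => [||z].
  - by apply: tameD => //; exact: tameB.
  - by apply: tameD; apply: tameZ; [exact: tame_radial_slope|exact: tame_gradnorm].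
  - by have := pw z; lra.
rewrite intRnD; [|by apply: tameZ; exact: tame_radial_slope|by apply: tameZ; exact: tame_gradnorm].
rewrite !intRnZ; [|exact: tame_gradnorm|exact: tame_radial_slope].
rewrite /smallness [leRHS]mulrDr; apply: lerD.
  apply: ler_wpM2r; first by apply: intRn_ge0; exact: radial_slope_ge0.
  by have := dim_const_ge0; lra.
rewrite [leRHS]mulrA; apply: ler_wpM2r; first by apply: intRn_ge0; exact: gradnorm_ge0.
by apply: ler_wpM2r => //; rewrite lerDr.
Qed.

End Estimates.

(** * Integration along segments *)

Definition unit_itv {R : realType} : set (measurableTypeR R) := `]0, 1]%classic.

Lemma unit_itvE {R : realType} (s : R) : unit_itv s <-> 0 < s <= 1.
Proof. by rewrite /unit_itv /= in_itv. Qed.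

Lemma lebesgue_unit_itv {R : realType} : @lebesgue_measure R unit_itv = 1%:E.
Proof. by rewrite /unit_itv lebesgue_measure_itv /= lte_fin ltr01 -EFinB subr0. Qed.

Section Segments.
Context {R : realType} {n : nat}.
Local Notation Rb := (measurableTypeR R).
Implicit Types (u F : 'rV[R]_n -> R) (a d : 'rV[R]_n).

Lemma line_continuous a d : continuous (fun s : R => a + s *: d).
Proof.
move=> s; apply: cvgD; first exact: cvg_cst.
by apply: cvgZr_tmp; exact: cvg_id.
Qed.

Lemma measurable_line F a d : borel F -> measurable_fun [set: Rb] (fun s => F (a + s *: d)).
Proof.
move=> mF; apply: (@borel_comp _ _ _ _ (fun s : Rb => a + s *: d)) mF => i.
apply: (eq_measurable_fun (fun s : Rb => a 0 i + s * d 0 i)).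
  by move=> s _; rewrite !mxE.
by apply: measurable_funD => //; apply: measurable_funM.
Qed.

Definition slope u d y : R := \sum_j d 0 j * on_ball (partial j u) y.

Lemma tame_slope u d : smooth_closed_ball u -> tame (slope u d).
Proof.
by move=> su; apply: tame_sum => j; apply: tameZ; exact: (smooth_tame [:: j] su).
Qed.

Lemma line_FTC u a d : smooth_closed_ball u ->
  (forall s : R, 0 <= s <= 1 -> eball 1 (a + s *: d)) ->
  (\int[@lebesgue_measure R]_(s in @unit_itv R) (slope u d (a + s *: d))%:E =
   (u (a + d) - u a)%:E)%E.
Proof.
move=> su aB.
pose f (s : R) := \sum_j d 0 j * partial j u (a + s *: d).
pose F (s : R) := u (a + s *: d).
have dF (s : R) : 0 <= s <= 1 -> is_derive s 1 F (f s).
  move=> s01; apply: is_derive_line; apply: is_derive_partial.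
  exact: (smooth_differentiable [::] su (aB s s01)).
have cF (s : R) : 0 <= s <= 1 -> {for s, continuous F}.
  move=> s01; apply: differentiable_continuous; apply/derivable1_diffP.
  by have := dF s s01 => H; exact: ex_derive.
have cf (s : R) : 0 <= s <= 1 -> {for s, continuous f}.
  move=> s01; apply: cvg_big => [|j _]; first exact: add_continuous.
  apply: cvgM; first exact: cvg_cst.
  apply: continuous_comp; first exact: line_continuous.
  apply: differentiable_continuous.
  exact: (smooth_differentiable [:: j] su (aB s s01)).
rewrite /unit_itv integral_itv_obnd_cbnd; last first.
  apply: measurable_funTS; apply/measurable_EFinP.
  by apply: measurable_line; apply: tame_borel; exact: tame_slope.
transitivity (\int[@lebesgue_measure R]_(s in `[0%R, 1%R]%classic) (f s)%:E)%E.
  apply: eq_integral => s; rewrite inE /= in_itv /= => s01; congr EFin.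
  by apply: eq_bigr => j _; rewrite on_ballE//; exact: aB.
rewrite (@continuous_FTC2 R f F 0 1)//.
- by rewrite /F scale1r scale0r addr0.
- apply/subspace_continuousP => s /=; rewrite in_itv /= => s01.
  by apply: cvg_within_filter; exact: cf.
- split.
  + move=> s; rewrite in_itv/= => /andP[s0 s1].
    by have H : is_derive s 1 F (f s) by apply: dF; rewrite !ltW.
  + apply: cvg_at_right_filter; apply: cF; rewrite lexx ler01//.
  + apply: cvg_at_left_filter; apply: cF; rewrite lexx ler01//.
- move=> s; rewrite in_itv/= => /andP[s0 s1].
  have H : is_derive s 1 F (f s) by apply: dF; rewrite !ltW.
  by rewrite derive1E derive_val.
Qed.

Lemma line_FTC_scale u a d (k : R) : smooth_closed_ball u ->
  (forall s : R, 0 <= s <= 1 -> eball 1 (a + s *: d)) ->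
  (\int[@lebesgue_measure R]_(s in @unit_itv R) (k * slope u d (a + s *: d))%:E =
   (k * (u (a + d) - u a))%:E)%E.
Proof.
move=> su aB.
rewrite EFinM -(line_FTC su aB) -integralZl//.
  exact: measurable_itv.
apply: measurable_bounded_integrable => //.
- exact: measurable_itv.
- by change (@lebesgue_measure R unit_itv < +oo)%E; rewrite lebesgue_unit_itv ltry.
- by apply: measurable_funTS; apply: measurable_line; apply: tame_borel; exact: tame_slope.
- have [M HM] := tame_bounded (tame_slope d su).
  exists M; split; first by rewrite num_real.
  by move=> K MK s _; apply: le_trans (HM _) (ltW MK).
Qed.

End Segments.

Section FubiniSegment.
Context {R : realType} {n : nat}.
Local Notation Rb := (measurableTypeR R).
Local Notation lam := (@lebesgue_measure R).

(** When [f] is obtained by integrating [Phi] over the parameter [s], as in the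
fundamental theorem of calculus along segments, bounds on the integral of [f]
may be proved for each [s] separately. *)
Lemma intRn_Fubini_le (Phi : R -> 'rV[R]_n -> R) (f : 'rV[R]_n -> R)
    (g : Rb -> \bar R) M r :
  measurable_fun [set: Rb * n.-tuple Rb] (fun p => Phi p.1 (vec_of_tuple p.2)) ->
  (forall s z, 0 < s <= 1 -> `|Phi s z| <= M) ->
  (forall s z, 0 < s <= 1 -> Phi s z != 0 -> `|z| < r) ->
  tame f ->
  (forall z, ((f z)%:E = \int[lam]_(s in @unit_itv R) (Phi s z)%:E)%E) ->
  measurable_fun [set: Rb] g ->
  (forall s : R, 0 < s <= 1 -> (`|intRn (Phi s)|%:E <= g s)%E) ->
  ((`|intRn f|)%:E <= \int[lam]_(s in @unit_itv R) g s)%E.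
Proof.
move=> mPhi PhiM Phir bf fE mg Phig.
pose I := @unit_itv R.
have mI : measurable I by exact: measurable_itv.
pose r' := Num.max r 1.
have r'0 : 0 < r' by rewrite lt_max ltr01 orbT.
have [mC eC] := lebesgue_Rn_cube (0 : 'rV[R]_n) r'0.
rewrite -(cubeE r'0) in mC eC.
set C := vec_of_tuple @^-1` _ in mC eC.
pose P (p : Rb * n.-tuple Rb) : \bar R := (Phi p.1 (vec_of_tuple p.2))%:E.
have mIC : measurable (I `*` C) by exact: measurableX.
pose Q := P \_ (I `*` C).
have iQ : (lam \x lebesgue_Rn n)%E.-integrable setT Q.
  apply/(integrable_mkcond _ mIC).
  apply: measurable_bounded_integrable => //.
  - change ((lam \x lebesgue_Rn n)%E (I `*` C) < +oo)%E.
    have -> : ((lam \x lebesgue_Rn n) (I `*` C) = lam I * lebesgue_Rn n C)%E.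
      exact: product_measure1E.
    by rewrite lebesgue_unit_itv eC -EFinM ltry.
  - exact: measurable_funTS.
  - exists M; split; first by rewrite num_real.
    move=> K MK [s t] [/= Is _]; apply: le_trans (ltW MK).
    by apply: PhiM; exact/unit_itvE.
have Phi0 s t : I s -> ~ C t -> Phi s (vec_of_tuple t) = 0.
  move=> /unit_itvE Is Ct; apply: contrapT => /eqP /(Phir s _ Is) H.
  by apply: Ct; rewrite /C /= lt_max H.
have QE s t : Q (s, t) = ((\1_I s * Phi s (vec_of_tuple t))%:E).
  rewrite /Q /patch indicE; have [Is|Is] := pselect (I s); last first.
    by rewrite memNset ?(memNset Is) ?mul0r// => -[].
  rewrite (mem_set Is) mul1r; have [Ct|Ct] := pselect (C t).
    by rewrite mem_set.
  by rewrite memNset ?Phi0// => -[].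
have bPhi s : I s -> tame (Phi s).
  move=> Is; split.
  - have := measurableT_comp mPhi (@pair1_measurable _ _ _ _ s).
    by apply: eq_measurable_fun.
  - by exists M => z; apply: PhiM; exact/unit_itvE.
  - by exists r => z; apply: Phir; exact/unit_itvE.
have E : (intRn f)%:E = (\int[lam]_s \int[lebesgue_Rn n]_t Q (s, t))%E.
  rewrite EFin_intRn// (Fubini iQ); apply: eq_integral => t _.
  rewrite fE [LHS]integral_mkcond; apply: eq_integral => s _.
  rewrite QE /patch indicE; case: ifPn => _; first by rewrite mul1r.
  by rewrite mul0r.
have F s : (\int[lebesgue_Rn n]_t Q (s, t))%E = ((\1_I s * intRn (Phi s))%:E).
  rewrite indicE; have [Is|Is] := pselect (I s).
    rewrite (mem_set Is) mul1r EFin_intRn; last exact: bPhi.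
    by apply: eq_integral => t _; rewrite QE indicE (mem_set Is) mul1r.
  rewrite (memNset Is) mul0r; apply: integral0_eq => t _.
  by rewrite QE indicE (memNset Is) mul0r.
rewrite -[leLHS]/(`|(intRn f)%:E|)%E E.
apply: le_trans (le_abse_integral _ measurableT (measurable_fubini_F iQ)) _.
rewrite [leRHS]integral_mkcond; apply: ge0_le_integral => //.
- by apply: measurableT_comp => //; exact: measurable_fubini_F iQ.
- by apply/(measurable_restrictT _ mI); exact: measurable_funTS.
- move=> s _; rewrite /fubini_F F /patch indicE /=.
  case: ifPn => [|_]; last by rewrite mul0r normr0.
  by rewrite inE mul1r => /unit_itvE Is; exact: Phig.
Qed.

Lemma measurable_ray (F : 'rV[R]_n -> R) (G : 'rV[R]_n -> R) x : borel F -> borel G ->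
  measurable_fun [set: Rb * n.-tuple Rb]
    (fun p => G (vec_of_tuple p.2) * F (x + p.1 *: vec_of_tuple p.2)).
Proof.
move=> mF mG; apply: measurable_funM.
  exact: (measurableT_comp mG measurable_snd).
apply: (@borel_comp _ _ _ _ (fun p : Rb * n.-tuple Rb => x + p.1 *: vec_of_tuple p.2)) mF.
move=> i; apply: (eq_measurable_fun
  (fun p : Rb * n.-tuple Rb => x 0 i + p.1 * tnth p.2 i)).
  by move=> p _; rewrite !mxE.
apply: measurable_funD => //; apply: measurable_funM => //.
exact: (measurableT_comp (measurable_tnth i) measurable_snd).
Qed.

Lemma measurable_translate (F : 'rV[R]_n -> R) (G : 'rV[R]_n -> R) x : borel F -> borel G ->
  measurable_fun [set: Rb * n.-tuple Rb]
    (fun p => G (vec_of_tuple p.2) * F (vec_of_tuple p.2 + p.1 *: x)).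
Proof.
move=> mF mG; apply: measurable_funM.
  exact: (measurableT_comp mG measurable_snd).
apply: (@borel_comp _ _ _ _ (fun p : Rb * n.-tuple Rb => vec_of_tuple p.2 + p.1 *: x)) mF.
move=> i; apply: (eq_measurable_fun
  (fun p : Rb * n.-tuple Rb => tnth p.2 i + p.1 * x 0 i)).
  by move=> p _; rewrite !mxE.
apply: measurable_funD => //; first exact: (measurableT_comp (measurable_tnth i) measurable_snd).
by apply: measurable_funM => //; exact: measurable_fst.
Qed.

End FubiniSegment.

(** * Mollification of a weak supersolution *)

Section Smoothing.
Context {R : realType} {n : nat}.
Local Notation Rb := (measurableTypeR R).
Local Notation lam := (@lebesgue_measure R).
Context (u H : 'rV[R]_n -> R) (D : R).
Hypothesis su : smooth_closed_ball u.
Hypothesis bH : tame H.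
Hypothesis H_ge0 : forall y, 0 <= H y.
Hypothesis dual : forall S K zeta dzeta x (s : R), testfun S K zeta dzeta ->
  0 <= s <= 1 -> (forall z, S z -> eball 1 (x + s *: z)) ->
  `|intRn (fun z => \sum_i dzeta i z * on_ball (partial i u) (x + s *: z))| <=
  K * intRn (fun z => \1_S z * H (x + s *: z)).
Hypothesis mass : intRn (fun y => \1_(@eclosed_ball R n (7 / 8)) y * H y) <= D.
Implicit Types (x y z : 'rV[R]_n).

Local Notation ua j := (on_ball (partial j u)).
Local Notation a1 := (9 / 64 : R).
Local Notation b1 := (25 / 64 : R).

(** The shell [3/8 <= |z| <= 5/8] is such that [|x| <= 1/4] and [|y - x|] in the shell
imply [1/8 <= |y| <= 7/8]: [mollifier (y - x)] only sees the annulus. *)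
Definition mollifier z : R := shell (9 / 64) (25 / 64) (sqn z).
Definition potential z : R := bump (9 / 64) (25 / 64) (sqn z).
Local Notation S := (@eclosed_ball R n (5 / 8)).

Let h1 : 0 <= a1. Proof. by lra. Qed.
Let h2 : a1 < b1. Proof. by lra. Qed.
Let h3 : b1 <= 1. Proof. by lra. Qed.

Lemma potential_testfun : testfun S 8 potential (fun i z => - (z 0 i * mollifier z)).
Proof.
apply: (bump_testfun h1 h2 h3); first by lra.
by rewrite (_ : 25 / 64 = (5 / 8) ^+ 2)//; field.
Qed.

Lemma mollifier_ge0 z : 0 <= mollifier z. Proof. exact: shell_ge0. Qed.

Lemma mollifier_le z : mollifier z <= 8. Proof. exact: (shell_le _ h1 h2 h3). Qed.

Lemma mollifier_out z : ~ S z -> mollifier z = 0.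
Proof.
move=> /negP; rewrite /eclosed_ball /= -ltNge => Sz; apply: (shell_out h2).
rewrite -enorm_sqr (_ : 25 / 64 = (5 / 8) ^+ 2); last by field.
by rewrite ler_pXn2r ?nnegrE ?enorm_ge0// ?ltW//; lra.
Qed.

Lemma mollifier_in z : enorm z <= 3 / 8 -> mollifier z = 0.
Proof.
move=> zl; apply: shell_in.
rewrite -enorm_sqr (_ : 9 / 64 = (3 / 8) ^+ 2); last by field.
by rewrite ler_pXn2r ?nnegrE ?enorm_ge0//; lra.
Qed.

Lemma tame_S : tame (\1_S : 'rV[R]_n -> R).
Proof. exact: testfun_tame_indic potential_testfun. Qed.

Lemma borel_mollifier : borel mollifier.
Proof. by apply: borel_shell; exact: borel_sqn. Qed.

Lemma tame_mollifier : tame mollifier.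
Proof.
apply: (tame_le borel_mollifier (tameZ 8 tame_S)) => z; rewrite indicE.
rewrite (ger0_norm (mollifier_ge0 z)); have [Sz|Sz] := pselect (S z).
  by rewrite mem_set// mulr1 ger0_norm// mollifier_le.
by rewrite (mollifier_out Sz) normr_ge0.
Qed.

(** Not normalized: the total mass of the kernel is [mollifier_mass]. *)
Definition mollify x : R := intRn (fun z => mollifier z * on_ball u (x + z)).
Definition mollifier_mass : R := intRn mollifier.

Let bu : tame (on_ball u). Proof. exact: (smooth_tame [::] su). Qed.

Let in78 x z (s : R) : enorm x <= 1 / 4 -> S z -> 0 <= s <= 1 ->
  eclosed_ball (7 / 8) (x + s *: z).
Proof.
rewrite /eclosed_ball /= => xl zl /andP[s0 s1].
apply: le_trans (enormD _ _) _; rewrite enormZ (ger0_norm s0).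
have := enorm_ge0 z; nra.
Qed.

Let in78' x z (s : R) : enorm x <= 1 / 4 -> S z -> 0 <= s <= 1 ->
  eclosed_ball (7 / 8) (z + s *: x).
Proof.
rewrite /eclosed_ball /= => xl zl /andP[s0 s1].
apply: le_trans (enormD _ _) _; rewrite enormZ (ger0_norm s0).
have := enorm_ge0 x; nra.
Qed.

Let in1 y : eclosed_ball (7 / 8) y -> eball 1 y.
Proof. by move=> /le_lt_trans; apply; lra. Qed.

Let tame_mollifierM (F : 'rV[R]_n -> R) x (s : R) : tame F ->
  tame (fun z => mollifier z * F (x + s *: z)).
Proof.
move=> bF; apply: tameM; first exact: tame_mollifier.
  exact: (borel_shift x s (tame_borel bF)).
by have [M FM] := tame_bounded bF; exists M => z; exact: FM.
Qed.

Let tame_mollifierM1 (F : 'rV[R]_n -> R) x : tame F ->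
  tame (fun z => mollifier z * F (x + z)).
Proof.
move=> bF; rewrite (_ : (fun _ => _) = fun z => mollifier z * F (x + 1 *: z)).
  exact: tame_mollifierM.
by apply/funext => z; rewrite scale1r.
Qed.

Lemma tame_local_mass x (s : R) : tame (fun z => \1_S z * H (x + s *: z)).
Proof.
apply: tameM; first exact: tame_S.
  exact: (borel_shift x s (tame_borel bH)).
by have [M FM] := tame_bounded bH; exists M => z; exact: FM.
Qed.

(** By the fundamental theorem of calculus along the segments from [x] to [x + z],
the difference is an integral over [s] of the pairing of [z . grad u (x + s z)]
with the mollifier, and [z * mollifier z] is minus the gradient of [potential]. *)
Lemma mollify_near x : enorm x <= 1 / 4 ->
  (`|mollify x - mollifier_mass * u x|%:E <=
   \int[lam]_(s in @unit_itv R) \int[lebesgue_Rn n]_t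
      (8 * (\1_S (vec_of_tuple t) * H (x + s *: vec_of_tuple t)))%:E)%E.
Proof.
move=> xl.
pose Phi (s : R) z := mollifier z * slope u z (x + s *: z).
pose f z := mollifier z * on_ball u (x + z) - u x * mollifier z.
have bf : tame f by apply: tameB; [exact: tame_mollifierM1|apply: tameZ; exact: tame_mollifier].
have PhiE s z : Phi s z = \sum_j (mollifier z * z 0 j) * ua j (x + s *: z).
  by rewrite /Phi /slope mulr_sumr; apply: eq_bigr => j _; rewrite mulrA.
have <- : intRn f = mollify x - mollifier_mass * u x.
  rewrite intRnB; [|exact: tame_mollifierM1|by apply: tameZ; exact: tame_mollifier].
  by rewrite (intRnZ _ tame_mollifier) [u x * _]mulrC.
have bkc j : tame (fun z => mollifier z * z 0 j).
  rewrite (_ : (fun _ => _) = fun z => - (- (z 0 j * mollifier z))).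
    by apply: tameN; exact: (testfun_dtame j potential_testfun).
  by apply/funext => z; rewrite opprK mulrC.
have bua j : tame (ua j) by exact: (smooth_tame [:: j] su).
have [M HM] : exists M, forall s z, `|Phi s z| <= M.
  have Mj j : {M | forall s z, `|(mollifier z * z 0 j) * ua j (x + s *: z)| <= M}.
    apply: cid; have [M1 H1] := tame_bounded (bkc j); have [M2 H2] := tame_bounded (bua j).
    by exists (M1 * M2) => s z; rewrite normrM; apply: ler_pM.
  exists (\sum_j sval (Mj j)) => s z; rewrite PhiE; apply: le_trans (ler_norm_sum _ _ _) _.
  by apply: ler_sum => j _; case: (Mj j) => Mx /=; apply.
have [r Hr] := tame_support tame_mollifier.
apply: (@intRn_Fubini_le _ _ Phi f _ M r) => //.
- apply: (eq_measurable_fun (fun p : Rb * n.-tuple Rb =>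
    \sum_j (mollifier (vec_of_tuple p.2) * (vec_of_tuple p.2) 0 j) *
      ua j (x + p.1 *: vec_of_tuple p.2))).
    by move=> p _; rewrite PhiE.
  apply: measurable_sum => j.
  exact: (measurable_ray _ (tame_borel (bua j)) (tame_borel (bkc j))).
- by move=> s z _ P0; apply: Hr; apply: contraNneq P0 => k0; rewrite /Phi k0 mul0r.
- move=> z; have [Sz|Sz] := pselect (S z); last first.
    rewrite /f /Phi (mollifier_out Sz) mul0r mulr0 subrr; apply/esym/integral0_eq => s _.
    by rewrite mul0r.
  rewrite (line_FTC_scale (a := x) (d := z) (mollifier z) su).
    rewrite /f on_ballE ?mulrBr ?[u x * _]mulrC//.
    rewrite -[z]scale1r; apply: in1; apply: in78 => //.
    by rewrite ler01 lexx.
  by move=> s s01; apply: in1; exact: in78.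
- apply: (measurable_fun_fubini_tonelli_F (fun p : Rb * n.-tuple Rb =>
    (8 * (\1_S (vec_of_tuple p.2) * H (x + p.1 *: vec_of_tuple p.2)))%:E)).
    apply/measurable_EFinP; apply: measurable_funM => //.
    exact: (measurable_ray _ (tame_borel bH) (tame_borel tame_S)).
  by move=> p; rewrite lee_fin !mulr_ge0// indicE.
- move=> s /andP[s0 s1].
  have s01 : 0 <= s <= 1 by rewrite ltW.
  have := dual potential_testfun s01 (fun z Sz => in1 (in78 xl Sz s01)).
  rewrite -intRnZ; last exact: tame_local_mass.
  rewrite -lee_fin EFin_intRn; last by apply: tameZ; exact: tame_local_mass.
  apply: le_trans; rewrite lee_fin -normrN -intRnN; last first.
    rewrite (_ : Phi s = fun z => \sum_j (mollifier z * z 0 j) * ua j (x + s *: z)).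
      apply: tame_sum => j.
      apply: tameM => //; first exact: (borel_shift x s (tame_borel (bua j))).
      by have [M' FM] := tame_bounded (bua j); exists M' => z; exact: FM.
    by apply/funext => z; exact: PhiE.
  rewrite le_eqVlt; apply/orP; left; apply/eqP; congr (`|intRn _|).
  apply/funext => z; rewrite PhiE -sumrN; apply: eq_bigr => j _.
  by ring.
Qed.

(** The squares differ by a product with the factor [|y - x| + |y| <= 9/4]. *)
Let sqn_lip x y : enorm x <= 1 / 4 -> enorm y <= 1 ->
  `|sqn (y - x) - sqn y| <= 4 * enorm x /\ sqn (y - x) <= 4 /\ sqn y <= 4.
Proof.
move=> xl yl; rewrite -!enorm_sqr.
have t1 : enorm (y - x) <= enorm y + enorm x.
  by apply: le_trans (enormD _ _) _; rewrite enormN.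
have t2 : enorm y <= enorm (y - x) + enorm x.
  by rewrite -{1}(subrK x y) enormD.
have p0 := enorm_ge0 x; have p1 := enorm_ge0 y; have p2 := enorm_ge0 (y - x).
split; last by split; nra.
rewrite subr_sqr normrM (ger0_norm (addr_ge0 p2 p1)) mulrC.
by apply: ler_pM; rewrite ?addr_ge0 ?ler_norml//; [lra|apply/andP; split; lra].
Qed.

Let mollifier_lip x y : enorm x <= 1 / 4 -> enorm y <= 1 ->
  `|mollifier (y - x) - mollifier y| <= 1056 * enorm x.
Proof.
move=> xl yl; have [L [s1 s2]] := sqn_lip xl yl.
apply: le_trans (shell_lip h1 h2 h3 s1 s2) _.
by lra.
Qed.

Let potential_lip x y : enorm x <= 1 / 4 -> enorm y <= 1 ->
  `|potential (y - x) - potential y| <= 64 * enorm x.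
Proof.
move=> xl yl; have [L [s1 s2]] := sqn_lip xl yl.
apply: le_trans (bump_lip h1 h2 h3 s1 s2) _.
by lra.
Qed.

Let translate_out x y : enorm x <= 1 / 4 -> ~ @eclosed_ball R n (7 / 8) y -> ~ S (y - x).
Proof.
move=> xl ny Sy; apply: ny; rewrite /eclosed_ball /= -(subrK x y).
by apply: le_trans (enormD _ _) _; move: Sy; rewrite /eclosed_ball /=; lra.
Qed.

Let S_sub y : ~ @eclosed_ball R n (7 / 8) y -> ~ S y.
Proof. by move=> ny Sy; apply: ny; move: Sy; rewrite /eclosed_ball /=; lra. Qed.

Let potential_out z : ~ S z -> potential z = 0.
Proof. by move=> /(tf_out potential_testfun). Qed.

Definition dpotential_diff x (i : 'I_n) y : R :=
  y 0 i * mollifier y - (y 0 i - x 0 i) * mollifier (y - x).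

(** The point is the factor [enorm x] in the bound; [8 + 5/4 * 1056 <= 2000], where
[1056] is a Lipschitz constant of [mollifier]. *)
Lemma potential_diff_testfun x : enorm x <= 1 / 4 ->
  testfun (@eclosed_ball R n (7 / 8)) (2000 * enorm x)
    (fun y => potential (y - x) - potential y) (dpotential_diff x).
Proof.
move=> xl; have x0 := enorm_ge0 x.
have sh (F : 'rV[R]_n -> R) : borel F -> borel (fun y => F (y - x)).
  move=> mF; rewrite (_ : (fun _ => _) = fun y => F (- x + 1 *: y)).
    exact: borel_shift.
  by apply/funext => y; rewrite scale1r addrC.
split.
- exact: closed_eclosed_ball.
- by exists 1 => z Bz /=; apply: le_lt_trans (norm_le_enorm z) (le_lt_trans Bz _); lra.
- by apply: borelB; [apply: sh|]; exact: tf_borel potential_testfun.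
- move=> i; apply: borelB; apply: borelM.
  + exact: borel_coord.
  + exact: borel_mollifier.
  + by apply: borelB; [exact: borel_coord|exact: borel_cst].
  + by apply: sh; exact: borel_mollifier.
- move=> y; have [By|By] := pselect (eclosed_ball (7 / 8) y).
    have yl : enorm y <= 1 by apply: le_trans By _; lra.
    by apply: le_trans (potential_lip xl yl) _; nra.
  rewrite !potential_out; [|exact: S_sub|exact: translate_out].
  by rewrite subrr normr0; lra.
- move=> i y; rewrite /dpotential_diff; have [By|By] := pselect (eclosed_ball (7 / 8) y).
    have yl : enorm y <= 1 by apply: le_trans By _; lra.
    have -> : y 0 i * mollifier y - (y 0 i - x 0 i) * mollifier (y - x) =
       x 0 i * mollifier y - (y 0 i - x 0 i) * (mollifier (y - x) - mollifier y) by ring.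
    apply: le_trans (ler_normB _ _) _.
    rewrite (normrM (x 0 i)) (normrM (y 0 i - x 0 i)).
    have k1 : `|x 0 i| * `|mollifier y| <= enorm x * 8.
      apply: ler_pM => //; first exact: coord_le_enorm.
      by rewrite ger0_norm ?mollifier_le ?mollifier_ge0.
    have k2 : `|y 0 i - x 0 i| * `|mollifier (y - x) - mollifier y| <= (5 / 4) * (1056 * enorm x).
      apply: ler_pM => //; last exact: mollifier_lip.
      apply: le_trans (ler_normB _ _) _.
      by have := coord_le_enorm y i; have := coord_le_enorm x i; lra.
    by apply: le_trans (lerD k1 k2) _; lra.
  rewrite !mollifier_out; [|exact: translate_out|exact: S_sub].
  by rewrite !mulr0 subrr normr0; lra.
- move=> y By; rewrite !potential_out; [|exact: S_sub|exact: translate_out].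
  by rewrite subrr.
- move=> i y By; rewrite /dpotential_diff !mollifier_out; [|exact: translate_out|exact: S_sub].
  by rewrite !mulr0 subrr.
- move=> i y.
  have e1 := tf_derive potential_testfun i (- x + 1 *: y).
  have := is_deriveB (is_derive_affine e1) (tf_derive potential_testfun i y).
  have -> : (fun z => potential (- x + 1 *: z)) - potential =
      (fun y => potential (y - x) - potential y).
    by apply/funext => z; rewrite /= !fctE scale1r [- x + z]addrC.
  have <- : 1 * - ((- x + 1 *: y) 0 i * mollifier (- x + 1 *: y)) - - (y 0 i * mollifier y)
     = dpotential_diff x i y.
    by rewrite /dpotential_diff scale1r [- x + y]addrC !mxE; ring.
  by [].
Qed.

Let bua j : tame (ua j). Proof. exact: (smooth_tame [:: j] su). Qed.

Let shell_annulus x y : enorm x <= 1 / 4 -> eball 1 y -> ~ annulus y ->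
  mollifier (y - x) = 0 /\ mollifier y = 0.
Proof.
move=> xl By nA.
have : eball (1 / 8) y by apply: contrapT => ny; apply: nA.
rewrite /eball /= => yl; split; apply: mollifier_in; last by lra.
by apply: le_trans (enormD _ _) _; rewrite enormN; lra.
Qed.

(** After translation the integrand is [mollifier (y - x) * (x . grad u y)].
Inserting [x = y - (y - x)], then subtracting and adding
[mollifier y * (y . grad u y)], splits it into the two terms [T1] and [T2] below.
The first term involves only the radial derivative, the second is a gradient of
[u] tested against the gradient of [potential (y - x) - potential y]. *)
Lemma shift_bound x : enorm x <= 1 / 4 ->
  `|intRn (fun z => mollifier z * slope u x (z + x))| <=
  enorm x * (1056 * intRn (radial_slope u) + 2000 * D).
Proof.
move=> xl; have x0 := enorm_ge0 x.
have tf := potential_diff_testfun xl.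
pose dot y := \sum_j y 0 j * ua j y.
have c0 : 0 <= 1056 * enorm x by lra.
pose T1 y := (mollifier (y - x) - mollifier y) * dot y.
pose T2 y := \sum_j dpotential_diff x j y * ua j y.
have bT2 : tame T2.
  apply: tame_sum => j; apply: tameM; first exact: (testfun_dtame j tf).
    exact: tame_borel.
  exact: tame_bounded.
have mk : borel (fun y => mollifier (y - x) - mollifier y).
  apply: borelB borel_mollifier; rewrite (_ : (fun _ => _) = fun y => mollifier (- x + 1 *: y)).
    by apply: borel_shift; exact: borel_mollifier.
  by apply/funext => y; rewrite scale1r addrC.
have T1le y : `|T1 y| <= 1056 * enorm x * radial_slope u y.
  rewrite /T1 normrM /radial_slope indicE.
  have [By|By] := pselect (eball 1 y); last first.
    rewrite /dot big1 ?normr0 ?mulr0 => [|j _]; first by rewrite lexx.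
    by rewrite on_ball_out// mulr0.
  have [Ay|Ay] := pselect (annulus y).
    by rewrite mem_set// mul1r; apply: ler_wpM2r => //; apply: mollifier_lip => //; exact: ltW.
  have [-> ->] := shell_annulus xl By Ay.
  by rewrite subrr normr0 mul0r (mulr_ge0 c0)// mulr_ge0// indicE.
have bR := tame_radial_slope su.
have bT1 : tame T1.
  apply: (@tame_le _ _ _ (fun y => 1056 * enorm x * radial_slope u y)) => [||y].
  - by apply: borelM => //; apply: tame_borel; exact: tame_dot.
  - exact: tameZ.
  - by apply: le_trans (T1le y) (ler_norm _).
have -> : intRn (fun z => mollifier z * slope u x (z + x)) = intRn (fun y => T1 y + T2 y).
  have bF : tame (fun z => mollifier z * slope u x (z + x)).
    rewrite (_ : (fun _ => _) = fun z => mollifier z * slope u x (x + z)).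
      by apply: tame_mollifierM1; exact: tame_slope.
    by apply/funext => z; rewrite addrC.
  rewrite -(intRn_shift (- x) bF); congr intRn; apply/funext => y.
  rewrite [- x + y]addrC subrK /T1 /T2 /slope /dot !mulr_sumr -big_split/=.
  by apply: eq_bigr => j _; rewrite /dpotential_diff; ring.
rewrite intRnD//; apply: le_trans (ler_normD _ _) _.
rewrite mulrDr; apply: lerD.
  rewrite (_ : enorm x * (1056 * _) = intRn (fun y => 1056 * enorm x * radial_slope u y)).
    by apply: normr_intRn_le => //; exact: tameZ.
  by rewrite intRnZ//; ring.
have E y : 0 + 1 *: y = y by rewrite add0r scale1r.
have := @dual _ _ _ _ 0 1 tf _ _.
have -> : (fun z => \sum_i dpotential_diff x i z * ua i (0 + 1 *: z)) = T2.
  by apply/funext => z; rewrite E.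
have -> : (fun z => \1_(@eclosed_ball R n (7 / 8)) z * H (0 + 1 *: z)) =
   (fun z => \1_(@eclosed_ball R n (7 / 8)) z * H z).
  by apply/funext => z; rewrite E.
move=> d; apply: le_trans (d _ _) _; [by rewrite ler01 lexx|by move=> z; rewrite E; exact: in1|].
rewrite mulrA [enorm x * 2000]mulrC; apply: ler_wpM2l; [lra|exact: mass].
Qed.

(** Differentiate [mollify] along the segment from [0] to [x].  The derivative at
[s *: x] is bounded by [shift_bound] divided by [s]; the factor [enorm (s *: x)]
there makes the quotient bounded as [s] tends to zero. *)
Lemma mollify_osc x : enorm x <= 1 / 4 ->
  `|mollify x - mollify 0| <= 1056 * intRn (radial_slope u) + 2000 * D.
Proof.
move=> xl; set B := 1056 * _ + _.
have D0 : 0 <= D.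
  by apply: le_trans mass; apply: intRn_ge0 => y; rewrite mulr_ge0// indicE.
have B0 : 0 <= B.
  have : 0 <= intRn (radial_slope u) by apply: intRn_ge0; exact: radial_slope_ge0.
  by rewrite /B; lra.
pose Phi (s : R) z := mollifier z * slope u x (z + s *: x).
pose f z := mollifier z * on_ball u (x + z) - mollifier z * on_ball u (0 + z).
have bf : tame f by apply: tameB; exact: tame_mollifierM1.
have <- : intRn f = mollify x - mollify 0.
  by rewrite intRnB//; exact: tame_mollifierM1.
have bsl := tame_slope x su.
have [M1 HM1] := tame_bounded tame_mollifier.
have [M2 HM2] := tame_bounded bsl.
have [r Hr] := tame_support tame_mollifier.
rewrite -lee_fin.
have -> : B%:E = (\int[lam]_(s in @unit_itv R) (cst B%:E s))%E.
  rewrite integral_cst; last exact: measurable_itv.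
  by rewrite [X in (_ * X)%E]lebesgue_unit_itv mule1.
apply: (@intRn_Fubini_le _ _ Phi f _ (M1 * M2) r) => //.
- exact: (measurable_translate _ (tame_borel bsl) borel_mollifier).
- by move=> s z _; rewrite /Phi normrM; apply: ler_pM.
- by move=> s z _ P0; apply: Hr; apply: contraNneq P0 => k0; rewrite /Phi k0 mul0r.
- move=> z; have [Sz|Sz] := pselect (S z); last first.
    rewrite /f /Phi (mollifier_out Sz) !mul0r subrr; apply/esym/integral0_eq => s _.
    by rewrite mul0r.
  have B1 (s : R) : 0 <= s <= 1 -> eball 1 (z + s *: x).
    by move=> s01; apply: in1; exact: in78'.
  rewrite (line_FTC_scale (a := z) (d := x) (mollifier z) su B1).
  have B10 : eball 1 z by have := B1 0; rewrite scale0r addr0; apply; rewrite lexx ler01.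
  have B11 : eball 1 (z + x) by have := B1 1; rewrite scale1r; apply; rewrite lexx ler01.
  by rewrite /f add0r addrC [x + z]addrC !on_ballE// addrC -mulrBr.
- move=> s /andP[s0 s1]; rewrite lee_fin.
  have sx : enorm (s *: x) <= 1 / 4.
    by rewrite enormZ gtr0_norm//; have := enorm_ge0 x; nra.
  have := shift_bound sx.
  have -> : intRn (fun z => mollifier z * slope u (s *: x) (z + s *: x)) = s * intRn (Phi s).
    rewrite -intRnZ; last first.
      rewrite /Phi (_ : (fun _ => _) = fun z => mollifier z * slope u x (s *: x + z)).
        exact: tame_mollifierM1.
      by apply/funext => z; rewrite addrC.
    congr intRn; apply/funext => z; rewrite /Phi mulrCA; congr (_ * _).
    by rewrite /slope mulr_sumr; apply: eq_bigr => j _; rewrite mxE mulrA.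
  rewrite enormZ normrM (gtr0_norm s0) -mulrA ler_pM2l// => /le_trans; apply.
  rewrite -/B; have := enorm_ge0 x; nra.
Qed.

End Smoothing.

(** * Estimate near the origin *)

Section TripleTonelli.
Context {R : realType} {n : nat}.
Local Notation Rb := (measurableTypeR R).
Local Notation lam := (@lebesgue_measure R).
Local Notation leb := (@lebesgue_Rn R n).
Implicit Types (G F : 'rV[R]_n -> R).

(** Integrating first in [x] removes the shift [s *: t] by translation invariance. *)
Lemma triple_tonelli F G : tame F -> tame G -> (forall y, 0 <= F y) ->
  (forall y, 0 <= G y) ->
  measurable_fun [set: n.-tuple Rb] (fun x => \int[lam]_(s in @unit_itv R) \int[leb]_t
     (G (vec_of_tuple t) * F (vec_of_tuple x + s *: vec_of_tuple t))%:E)%E /\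
  (\int[leb]_x \int[lam]_(s in @unit_itv R) \int[leb]_t
     (G (vec_of_tuple t) * F (vec_of_tuple x + s *: vec_of_tuple t))%:E
   = (intRn G * intRn F)%:E)%E.
Proof.
move=> bF bG F0 G0.
have mI : measurable (@unit_itv R) by exact: measurable_itv.
pose Psi (p : (n.-tuple Rb * Rb) * n.-tuple Rb) : \bar R :=
  ((G (vec_of_tuple p.2) * \1_unit_itv p.1.2) *
    F (vec_of_tuple p.1.1 + p.1.2 *: vec_of_tuple p.2))%:E.
have Psi0 p : (0 <= Psi p)%E.
  by rewrite /Psi lee_fin !mulr_ge0// indicE.
have mPsi : measurable_fun setT Psi.
  apply/measurable_EFinP; apply: measurable_funM.
    apply: measurable_funM.
      exact: (measurableT_comp (tame_borel bG) measurable_snd).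
    apply: (measurableT_comp (measurable_indic mI)).
    exact: (measurableT_comp measurable_snd measurable_fst).
  apply: (@borel_comp _ _ _ _ (fun p : (n.-tuple Rb * Rb) * n.-tuple Rb =>
     vec_of_tuple p.1.1 + p.1.2 *: vec_of_tuple p.2)) (tame_borel bF) => i.
  apply: (eq_measurable_fun (fun p : (n.-tuple Rb * Rb) * n.-tuple Rb =>
    tnth p.1.1 i + p.1.2 * tnth p.2 i)).
    by move=> p _; rewrite !mxE.
  apply: measurable_funD.
    exact: (measurableT_comp (measurable_tnth i)
      (measurableT_comp measurable_fst measurable_fst)).
  apply: measurable_funM.
    exact: (measurableT_comp measurable_snd measurable_fst).
  exact: (measurableT_comp (measurable_tnth i) measurable_snd).
pose g (q : n.-tuple Rb * Rb) := (\int[leb]_t Psi (q, t))%E.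
have g0 q : (0 <= g q)%E by exact: integral_ge0.
have mg : measurable_fun setT g by exact: (measurable_fun_fubini_tonelli_F Psi).
have gE x : (\int[lam]_(s in @unit_itv R) \int[leb]_t
     (G (vec_of_tuple t) * F (vec_of_tuple x + s *: vec_of_tuple t))%:E =
   \int[lam]_s g (x, s))%E.
  rewrite [LHS]integral_mkcond; apply: eq_integral => s _.
  rewrite /patch /g /Psi /= indicE; case: ifPn => Is.
    by apply: eq_integral => t _; rewrite mulr1.
  by apply/esym/integral0_eq => t _; rewrite mulr0 mul0r.
split.
  apply: (eq_measurable_fun (fun x => \int[lam]_s g (x, s))%E).
    by move=> x _; rewrite gE.
  exact: (measurable_fun_fubini_tonelli_F g).
transitivity (\int[leb]_x \int[lam]_s g (x, s))%E.
  by apply: eq_integral => x _; exact: gE.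
rewrite (fubini_tonelli g)//.
transitivity (\int[lam]_s (((\1_unit_itv s : R)%:E) * (intRn G * intRn F)%:E))%E.
  apply: eq_integral => s _; rewrite /g.
  have ms : measurable_fun setT (fun p : n.-tuple Rb * n.-tuple Rb => Psi ((p.1, s), p.2)).
    apply: (measurableT_comp mPsi); apply/measurable_fun_pairP; split => /=.
      by apply/measurable_fun_pairP; split => /=; [exact: measurable_fst|exact: measurable_cst].
    exact: measurable_snd.
  rewrite (fubini_tonelli (fun p : n.-tuple Rb * n.-tuple Rb => Psi ((p.1, s), p.2)))//=.
  transitivity (\int[leb]_t ((\1_unit_itv s * intRn F)%:E * (G (vec_of_tuple t))%:E))%E.
    apply: eq_integral => t _; rewrite /Psi /=.
    rewrite (eq_integral (fun x => (G (vec_of_tuple t) * \1_unit_itv s)%:E *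
        (F (s *: vec_of_tuple t + 1 *: vec_of_tuple x))%:E)%E); last first.
      by move=> x _; rewrite -EFinM scale1r [_ + vec_of_tuple x]addrC.
    rewrite ge0_integralZl_EFin//; last 3 first.
    - by move=> x _; rewrite lee_fin.
    - apply/measurable_EFinP.
      exact: (borel_shift (s *: vec_of_tuple t) 1 (tame_borel bF)).
    - by rewrite mulr_ge0// indicE.
    have mF : eborel (EFin \o F).
      exact: ((measurable_EFinP setT (F \o vec_of_tuple)).2 (tame_borel bF)).
    have F0' y : (0 <= (EFin \o F) y)%E by rewrite lee_fin.
    rewrite (eintegral_affine (s *: vec_of_tuple t) ltr01 mF F0').
    rewrite expr1n invr1 mul1e /= -EFin_intRn// -!EFinM; congr EFin; ring.
  rewrite ge0_integralZl_EFin//; last 3 first.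
  - by move=> x _; rewrite lee_fin.
  - by apply/measurable_EFinP; exact: (tame_borel bG).
  - by rewrite mulr_ge0 ?intRn_ge0// indicE.
  by rewrite -EFin_intRn// -!EFinM; congr EFin; ring.
rewrite (eq_integral (fun s => (intRn G * intRn F)%:E * (\1_unit_itv s : R)%:E)%E); last first.
  by move=> s _; rewrite muleC.
rewrite ge0_integralZl_EFin//.
- by rewrite integral_indic// setIT [X in (_ * X)%E]lebesgue_unit_itv mule1.
- by apply/measurable_EFinP; exact: measurable_indic.
- by rewrite mulr_ge0// intRn_ge0.
Qed.

End TripleTonelli.

Section NearBound.
Context {R : realType} {n : nat}.
Local Notation Rb := (measurableTypeR R).
Local Notation lam := (@lebesgue_measure R).
Local Notation leb := (@lebesgue_Rn R n).

(** The kernel is bounded below near the point at distance [1/2] from the origin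
on the first axis; this is where a positive dimension is used. *)
Lemma mollifier_mass_gt0 : (0 < n)%N -> 0 < @mollifier_mass R n.
Proof.
move=> n0.
pose p : 'rV[R]_n := 2^-1 *: delta_mx 0 (Ordinal n0).
have sp : sqn p = 1 / 4.
  rewrite /sqn (bigD1 (Ordinal n0))//= big1 => [|j jn]; last first.
    by rewrite !mxE (negbTE jn) andbF mulr0 expr0n.
  by rewrite !mxE !eqxx /= mulr1 addr0; field.
have kp : 0 < mollifier p by rewrite /mollifier sp; apply: shell_gt0; lra.
have /nbhs_ballP [r /= r0 rB] : nbhs p [set x : 'rV[R]_n | 15 / 64 < sqn x < 17 / 64].
  have /(_ p) c := @sqn_continuous R n.
  have H0 : nbhs (sqn p) `](15 / 64 : R), (17 / 64)[%classic.
    apply: open_nbhs_nbhs; split; first exact: interval_open.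
    by rewrite /= in_itv/= sp; apply/andP; split; lra.
  have H1 : nbhs p (sqn @^-1` `](15 / 64 : R), (17 / 64)[%classic) by exact: c.
  by apply: filterS H1 => x /=; rewrite in_itv.
(* the value of the kernel with each factor replaced by its infimum over
   [15/64 < |x| ^ 2 < 17/64] *)
pose k0 : R := 8 * ((25/64 - 9/64) ^+ 2 - (8/64) ^+ 2) * (6 / 64).
have k00 : 0 < k0 by rewrite /k0; lra.
pose C := [set x : 'rV[R]_n | forall i, `|p 0 i - x 0 i| < r].
have [mC eC] := lebesgue_Rn_cube p r0.
rewrite -/C in mC eC.
have bC : tame (\1_C : 'rV[R]_n -> R).
  apply: (tame_indic (r := `|p| + r)) => // x Cx /=.
  rewrite -(subrK p x) addrC; apply: le_lt_trans (ler_normD _ _) _; rewrite ltrD2l.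
  rewrite -[`|_|]/(mx_norm (x - p)) mx_normrE; apply/bigmax_ltP; split => //.
  by move=> [i j] _ /=; rewrite ord1 [(x - p) 0 j]mxE [(- p) 0 j]mxE distrC; exact: Cx.
have kC x : k0 * \1_C x <= mollifier x.
  rewrite indicE; have [Cx|Cx] := pselect (C x); last first.
    by rewrite memNset// mulr0 mollifier_ge0.
  rewrite mem_set// mulr1.
  have : ball p r x by split => // i j; rewrite ord1 -ball_normE; exact: Cx.
  move=> /rB /= /andP[s1 s2].
  have p1 : ramp (sqn x - 9 / 64) = sqn x - 9 / 64 by rewrite ramp_id//; lra.
  rewrite /mollifier /shell /bump_core p1 ramp_id; last by nra.
  rewrite /k0 -!mulrA ler_pM2l//; apply: ler_pM; nra.
apply: (@lt_le_trans _ _ (intRn (fun x => k0 * \1_C x))); last first.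
  by apply: le_intRn => //; [exact: tameZ|exact: tame_mollifier].
rewrite intRnZ// mulr_gt0// -lte_fin EFin_intRn//.
rewrite (_ : (\int[leb]_t _)%E = leb (vec_of_tuple @^-1` C)).
  by rewrite eC lte_fin exprn_gt0//; lra.
rewrite -[in RHS](setIT (vec_of_tuple @^-1` C)) -integral_indic//.
Qed.

Context (u H : 'rV[R]_n -> R) (D : R).
Hypothesis su : smooth_closed_ball u.
Hypothesis bH : tame H.
Hypothesis H_ge0 : forall y, 0 <= H y.
Hypothesis dual : forall S K zeta dzeta x (s : R), testfun S K zeta dzeta ->
  0 <= s <= 1 -> (forall z, S z -> eball 1 (x + s *: z)) ->
  `|intRn (fun z => \sum_i dzeta i z * on_ball (partial i u) (x + s *: z))| <=
  K * intRn (fun z => \1_S z * H (x + s *: z)).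
Hypothesis mass : intRn (fun y => \1_(@eclosed_ball R n (7 / 8)) y * H y) <= D.
Hypothesis n_gt0 : (0 < n)%N.
Local Notation c := (@mollifier_mass R n).
Local Notation Q := (@eclosed_ball R n (1 / 4)).
Local Notation S := (@eclosed_ball R n (5 / 8)).

Definition center : R := mollify u 0 / c.

Lemma near_bound :
  (\int[leb]_t (\1_Q (vec_of_tuple t) * `|on_ball u (vec_of_tuple t) - center|)%:E <=
   (c^-1 * (intRn (fun z : 'rV[R]_n => 8 * \1_S z) * D +
     intRn (\1_Q : 'rV[R]_n -> R) * (1056 * intRn (radial_slope u) + 2000 * D)))%:E)%E.
Proof.
have c0 := mollifier_mass_gt0 n_gt0.
pose H7 y := \1_(@eclosed_ball R n (7 / 8)) y * H y.
pose G z : R := 8 * \1_S z.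
pose B := 1056 * intRn (radial_slope u) + 2000 * D.
have bG : tame G by apply: tameZ; exact: tame_S.
have b78 : tame (\1_(@eclosed_ball R n (7 / 8)) : 'rV[R]_n -> R).
  apply: (tame_indic (r := 1)).
    by apply: measurable_closed; exact: closed_eclosed_ball.
  by move=> z Bz /=; apply: le_lt_trans (norm_le_enorm z) (le_lt_trans Bz _); lra.
have bQ : tame (\1_Q : 'rV[R]_n -> R).
  apply: (tame_indic (r := 1)).
    by apply: measurable_closed; exact: closed_eclosed_ball.
  by move=> z Bz /=; apply: le_lt_trans (norm_le_enorm z) (le_lt_trans Bz _); lra.
have bH7 : tame H7.
  by apply: tameM => //; [exact: tame_borel|exact: tame_bounded].
have H70 y : 0 <= H7 y by rewrite mulr_ge0// indicE.
have G0 y : 0 <= G y by rewrite mulr_ge0// indicE.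
have [mW EW] := triple_tonelli bH7 bG H70 G0.
set W := (fun x : n.-tuple Rb => (\int[lam]_(s in _) _)%E) in mW EW.
have W0 x : (0 <= W x)%E.
  by apply: integral_ge0 => s _; apply: integral_ge0 => t _; rewrite lee_fin mulr_ge0.
have D0 : 0 <= D.
  by apply: le_trans mass; apply: intRn_ge0 => y; rewrite mulr_ge0// indicE.
have B0 : 0 <= B.
  have : 0 <= intRn (radial_slope u) by apply: intRn_ge0; exact: radial_slope_ge0.
  by rewrite /B; lra.
have pw (t : n.-tuple Rb) : ((\1_Q (vec_of_tuple t) * `|on_ball u (vec_of_tuple t) - center|)%:E <=
   c^-1%:E * W t + (c^-1 * (\1_Q (vec_of_tuple t) * B))%:E)%E.
  set x := vec_of_tuple t; rewrite indicE; have [Qx|Qx] := pselect (Q x); last first.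
    rewrite memNset// !mul0r mulr0 adde0 mule_ge0//.
    by rewrite lee_fin invr_ge0 ltW.
  rewrite mem_set// !mul1r.
  have Bx : eball 1 x by apply: (le_lt_trans Qx); lra.
  rewrite on_ballE//.
  have E1 := mollify_near su bH H_ge0 dual Qx.
  have E2 := mollify_osc su H_ge0 dual mass Qx.
  have {}E1 : (`|mollify u x - c * u x|%:E <= W t)%E.
    apply: le_trans E1 _; rewrite le_eqVlt; apply/orP; left; apply/eqP.
    apply: eq_integral => s; rewrite inE => /unit_itvE /andP[s0 s1].
    apply: eq_integral => t' _; congr EFin; rewrite /G /H7 -mulrA; congr (8 * _).
    rewrite !indicE; have [Sz|Sz] := pselect (S (vec_of_tuple t')); last first.
      by rewrite memNset// !mul0r.
    rewrite (mem_set Sz) !mul1r mem_set ?mul1r//.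
    move: Qx Sz; rewrite /eclosed_ball /= => Qx Sz.
    apply: le_trans (enormD _ _) _; rewrite enormZ gtr0_norm//.
    by have := enorm_ge0 (vec_of_tuple t'); nra.
  have : `|u x - center| <= c^-1 * `|mollify u x - c * u x| + c^-1 * B.
    rewrite -mulrDr ler_pdivlMl//.
    rewrite -{1}(gtr0_norm c0) -normrM /center.
    have -> : c * (u x - mollify u 0 / c) =
       (mollify u x - mollify u 0) - (mollify u x - c * u x).
      by field; rewrite gt_eqF.
    apply: le_trans (ler_normB _ _) _; rewrite addrC lerD2l; exact: E2.
  rewrite -lee_fin EFinD => /le_trans; apply; apply: leeD => //.
  by rewrite EFinM lee_pmul2l// lte_fin invr_gt0.
apply: (@le_trans _ _ (\int[leb]_t (c^-1%:E * W t +
   (c^-1 * (\1_Q (vec_of_tuple t) * B))%:E)))%E.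
  apply: ge0_le_integral => //.
  - apply/measurable_EFinP; apply: measurable_funM; first exact: tame_borel bQ.
    apply: (borel_norm (F := fun y => on_ball u y - center)); apply: borelB; last exact: borel_cst.
    exact: tame_borel (smooth_tame [::] su).
  - apply: emeasurable_funD; first exact: measurable_funeM.
    apply/measurable_EFinP; apply: measurable_funM => //.
    by apply: measurable_funM => //; exact: tame_borel bQ.
have ci0 : 0 <= c^-1 by rewrite invr_ge0 ltW.
rewrite ge0_integralD//; last 4 first.
- by move=> t _; rewrite mule_ge0.
- exact: measurable_funeM.
- by move=> t _; rewrite lee_fin !mulr_ge0// indicE.
- apply/measurable_EFinP; apply: measurable_funM => //.
  by apply: measurable_funM => //; exact: tame_borel bQ.
rewrite ge0_integralZl_EFin// EW.
have b0 : tame (fun z => \1_Q z * B).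
  by apply: tameM => //; [exact: borel_cst|exists `|B| => y].
rewrite -(EFin_intRn (tameZ c^-1 b0)) -EFinM -EFinD lee_fin (intRnZ _ b0).
have -> : intRn (fun z => \1_Q z * B) = intRn (\1_Q : 'rV[R]_n -> R) * B.
  by rewrite [RHS]mulrC -(intRnZ _ bQ); congr intRn; apply/funext => y; exact: mulrC.
rewrite -mulrDr ler_pM2l ?invr_gt0// lerD2r; apply: ler_wpM2l; last exact: mass.
exact: intRn_ge0.
Qed.

End NearBound.

(** * Propagation along rays *)

Section Dyadic.
Context {R : realType} {n : nat}.
Local Notation Rb := (measurableTypeR R).
Local Notation lam := (@lebesgue_measure R).
Local Notation leb := (@lebesgue_Rn R n).
Context (u : 'rV[R]_n -> R) (su : smooth_closed_ball u).
Implicit Types (x y : 'rV[R]_n) (f : 'rV[R]_n -> R).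

Lemma intRn_dilate f (s : R) : 0 < s -> tame f -> (forall y, 0 <= f y) ->
  (\int[leb]_t (f (s *: vec_of_tuple t))%:E = (s ^- n * intRn f)%:E)%E.
Proof.
move=> s0 bf f0.
have mF : eborel (EFin \o f).
  exact: ((measurable_EFinP setT (f \o vec_of_tuple)).2 (tame_borel bf)).
have F0 y : (0 <= (EFin \o f) y)%E by rewrite lee_fin.
have := eintegral_affine 0 s0 mF F0.
rewrite -(EFin_intRn bf) -EFinM => <-.
by apply: eq_integral => t _; rewrite /= add0r.
Qed.

Definition radial_avg (t : n.-tuple Rb) : \bar R :=
  (\int[lam]_(s in @unit_itv R) (radial_slope u (((1 + s) / 2) *: vec_of_tuple t))%:E)%E.

(** The dilation by [(1 + s) / 2 >= 1/2] costs at most the factor [2 ^ n]. *)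
Lemma radial_avg_bound : measurable_fun setT radial_avg /\
  (\int[leb]_t radial_avg t <= (2 ^+ n * intRn (radial_slope u))%:E)%E.
Proof.
have mI : measurable (@unit_itv R) by exact: measurable_itv.
have bR := tame_radial_slope su.
pose g (p : n.-tuple Rb * Rb) :=
  (\1_unit_itv p.2 * radial_slope u (((1 + p.2) / 2) *: vec_of_tuple p.1))%:E.
have g0 p : (0 <= g p)%E by rewrite lee_fin mulr_ge0 ?radial_slope_ge0// indicE.
have mg : measurable_fun setT g.
  apply/measurable_EFinP; apply: measurable_funM.
    exact: (measurableT_comp (measurable_indic mI) measurable_snd).
  apply: (@borel_comp _ _ _ _ (fun p : n.-tuple Rb * Rb =>
    ((1 + p.2) / 2) *: vec_of_tuple p.1)) (tame_borel bR) => i.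
  apply: (eq_measurable_fun (fun p : n.-tuple Rb * Rb => ((1 + p.2) / 2) * tnth p.1 i)).
    by move=> p _; rewrite !mxE.
  apply: measurable_funM.
    by apply: measurable_funM => //; apply: measurable_funD.
  exact: (measurableT_comp (measurable_tnth i) measurable_fst).
have gE t : (radial_avg t = \int[lam]_s g (t, s))%E.
  rewrite /radial_avg integral_mkcond; apply: eq_integral => s _.
  rewrite /patch /g /= indicE; case: ifPn => _; first by rewrite mul1r.
  by rewrite mul0r.
split.
  apply: (eq_measurable_fun (fun t => \int[lam]_s g (t, s))%E).
    by move=> t _; rewrite gE.
  exact: (measurable_fun_fubini_tonelli_F g).
rewrite (eq_integral (fun t => \int[lam]_s g (t, s))%E); last by move=> t _; exact: gE.
rewrite (fubini_tonelli g)//.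
apply: (@le_trans _ _ (\int[lam]_s
  ((2 ^+ n * intRn (radial_slope u))%:E * (\1_unit_itv s : R)%:E))%E).
  apply: ge0_le_integral => //.
  - by move=> s _; apply: integral_ge0 => t _; exact: g0.
  - exact: (measurable_fun_fubini_tonelli_G g).
  - by apply: measurable_funeM; apply/measurable_EFinP; exact: measurable_indic.
  - move=> s _; rewrite /g indicE /=.
    have [Is|Is] := pselect (unit_itv s); last first.
      rewrite memNset// mule0 le_eqVlt; apply/orP; left; apply/eqP.
      by apply: integral0_eq => t _; rewrite mul0r.
    rewrite mem_set// mule1.
    have /andP[s0 s1] := (unit_itvE s).1 Is.
    rewrite (eq_integral
      (fun t => (radial_slope u (((1 + s) / 2) *: vec_of_tuple t))%:E)); last first.
      by move=> t _; rewrite mul1r.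
    have p0 : 0 < (1 + s) / 2 by lra.
    rewrite (intRn_dilate p0 bR (radial_slope_ge0 u)) lee_fin; apply: ler_wpM2r.
      by apply: intRn_ge0; exact: radial_slope_ge0.
    rewrite -exprVn; apply: lerXn2r; rewrite ?nnegrE ?invr_ge0 ?(ltW p0)//.
    by rewrite -[leRHS]invrK lef_pV2 ?posrE ?invr_gt0//; lra.
have I0 : 0 <= 2 ^+ n * intRn (radial_slope u).
  by rewrite mulr_ge0 ?exprn_ge0// intRn_ge0//; exact: radial_slope_ge0.
rewrite ge0_integralZl_EFin//.
- by rewrite integral_indic// setIT [X in (_ * X)%E]lebesgue_unit_itv mule1.
- by apply/measurable_EFinP; exact: measurable_indic.
Qed.

Definition dyadic (r : R) : set 'rV[R]_n := eball (2 * r) `\` eball r.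

Definition L1_dist (A : set 'rV[R]_n) (t : R) : R := intRn (fun y => \1_A y * `|on_ball u y - t|).

Lemma measurable_dyadic (r : R) :
  measurable (vec_of_tuple @^-1` dyadic r : set (n.-tuple Rb)).
Proof.
rewrite /dyadic -[X in measurable X]/((vec_of_tuple @^-1` eball (2 * r)) `\`
  (vec_of_tuple @^-1` eball r)).
by apply: measurableD; exact: measurable_eball.
Qed.

Lemma tame_L1_dist (A : set 'rV[R]_n) t : tame (\1_A : 'rV[R]_n -> R) ->
  tame (fun y => \1_A y * `|on_ball u y - t|).
Proof.
move=> bA; have bu := smooth_tame [::] su.
apply: tameM => //.
  by apply: borel_norm; apply: borelB; [exact: tame_borel bu|exact: borel_cst].
have [M HM] := tame_bounded bu.
exists (M + `|t|) => y; rewrite normr_id.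
by apply: le_trans (ler_normB _ _) _; rewrite lerD2r; exact: HM.
Qed.

Lemma tame_indic_dyadic (r : R) : tame (\1_(dyadic r) : 'rV[R]_n -> R).
Proof.
apply: (tame_indic (r := 2 * r)); first exact: measurable_dyadic.
by move=> x [Bx _] /=; apply: le_lt_trans (norm_le_enorm x) Bx.
Qed.

(** Halving maps one ring onto the previous one, and [u x - u (x / 2)] is the
integral of the radial derivative along a segment that stays in the annulus. *)
Lemma dyadic_step (r t : R) : 1 / 8 <= r -> 4 * r <= 1 ->
  L1_dist (dyadic (2 * r)) t <= 2 ^+ n * (L1_dist (dyadic r) t + intRn (radial_slope u)).
Proof.
move=> r8 r4.
have bf := tame_L1_dist t (tame_indic_dyadic r).
have bf2 := tame_L1_dist t (tame_indic_dyadic (2 * r)).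
set f := (fun y => _ * _) in bf.
have f0 y : 0 <= f y by rewrite mulr_ge0// indicE.
have [mV EV] := radial_avg_bound.
have V0 (x : n.-tuple Rb) : (0 <= radial_avg x)%E.
  by apply: integral_ge0 => s _; rewrite lee_fin radial_slope_ge0.
have pw (s : n.-tuple Rb) :
  ((\1_(dyadic (2 * r)) (vec_of_tuple s) * `|on_ball u (vec_of_tuple s) - t|)%:E <=
   (f (2^-1 *: vec_of_tuple s))%:E + radial_avg s)%E.
  rewrite /radial_avg; set x := vec_of_tuple s.
  rewrite indicE; have [Dx|Dx] := pselect (dyadic (2 * r) x); last first.
    by rewrite memNset// mul0r adde_ge0 ?lee_fin ?f0// V0.
  have [x1 x2] : enorm x < 4 * r /\ 2 * r <= enorm x.
    move: Dx => [h1 /negP]; rewrite /eball /= -leNgt => h2; split => //.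
    by apply: lt_le_trans h1 _; rewrite mulrA; lra.
  have hx : enorm (2^-1 *: x) = enorm x / 2.
    by rewrite enormZ gtr0_norm ?invr_gt0// mulrC.
  have D1 : dyadic r (2^-1 *: x).
    by rewrite /dyadic /eball; split; rewrite /= hx; [lra|apply/negP; rewrite -leNgt; lra].
  rewrite mem_set// mul1r /f indicE (mem_set D1) mul1r.
  have sB (a : R) : 0 <= a <= 1 -> eball 1 (2^-1 *: x + a *: (2^-1 *: x)).
    move=> /andP[a0 a1]; rewrite -{1}[2^-1 *: x]scale1r -scalerDl /eball /= enormZ hx.
    rewrite ger0_norm; last by lra.
    by have := enorm_ge0 x; nra.
  have B1 : eball 1 (2^-1 *: x) by have := sB 0; rewrite scale0r addr0; apply; rewrite lexx ler01.
  have B2 : eball 1 x.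
    have := sB 1; rewrite scale1r -scalerDl (_ : 2^-1 + 2^-1 = 1) ?scale1r; last by field.
    by apply; rewrite lexx ler01.
  rewrite !on_ballE//.
  apply: (@le_trans _ _ ((`|u (2^-1 *: x) - t|)%:E + (`|u x - u (2^-1 *: x)|)%:E)%E).
    rewrite -EFinD lee_fin.
    by rewrite (_ : u x - t = (u (2^-1 *: x) - t) + (u x - u (2^-1 *: x))) ?ler_normD//; ring.
  apply: leeD => //.
  have E2 : (2^-1 + 2^-1) *: x = x.
    by rewrite (_ : 2^-1 + 2^-1 = 1) ?scale1r//; field.
  rewrite -{1}E2 scalerDl -[leLHS]/(`|(u (2^-1 *: x + 2^-1 *: x) - u (2^-1 *: x))%:E|)%E.
  rewrite -(line_FTC su sB).
  have msl : measurable_fun (@unit_itv R)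
     (fun a : Rb => (slope u (2^-1 *: x) (2^-1 *: x + a *: (2^-1 *: x)))%:E).
    apply: measurable_funTS; apply/measurable_EFinP.
    by apply: measurable_line; apply: tame_borel; exact: tame_slope.
  have mI : measurable (@unit_itv R) by exact: measurable_itv.
  apply: le_trans (le_abse_integral _ mI msl) _.
  apply: ge0_le_integral => //.
  - exact: measurableT_comp.
  - apply: measurable_funTS; apply/measurable_EFinP.
    apply: (@borel_comp _ _ _ _ (fun a : Rb => ((1 + a) / 2) *: x))
      (tame_borel (tame_radial_slope su)).
    move=> i; apply: (eq_measurable_fun (fun a : Rb => ((1 + a) / 2) * x 0 i)).
      by move=> a _; rewrite !mxE.
    by apply: measurable_funM => //; apply: measurable_funM => //; apply: measurable_funD.
  - move=> a /unit_itvE /andP[a0 a1]; rewrite lee_fin.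
    have Ea : 2^-1 *: x + a *: (2^-1 *: x) = ((1 + a) / 2) *: x.
      by rewrite scalerA -scalerDl; congr (_ *: _); field.
    rewrite Ea; set y := ((1 + a) / 2) *: x.
    have By : eball 1 y by rewrite /y -Ea; apply: sB; rewrite ltW.
    have Ay : annulus y.
      split => //; rewrite /eball /=; apply/negP; rewrite -leNgt /y enormZ ger0_norm; last by lra.
      by have := enorm_ge0 x; nra.
    rewrite /radial_slope indicE (mem_set Ay) mul1r.
    have -> : slope u (2^-1 *: x) y = (1 + a)^-1 * \sum_j y 0 j * on_ball (partial j u) y.
      rewrite /slope mulr_sumr; apply: eq_bigr => j _.
      by rewrite /y !mxE; field; rewrite gt_eqF//; lra.
    rewrite normrM gtr0_norm; last by rewrite invr_gt0; lra.
    by apply: ler_piMl => //; rewrite invf_le1; lra.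
rewrite -lee_fin {1}/L1_dist EFin_intRn//.
apply: (@le_trans _ _ (\int[leb]_s ((f (2^-1 *: vec_of_tuple s))%:E + radial_avg s))%E).
  apply: ge0_le_integral => //.
  - by apply/measurable_EFinP; exact: (tame_borel bf2).
  - apply: emeasurable_funD => //; apply/measurable_EFinP.
    rewrite (_ : (fun _ => _) = (fun y => f (0 + 2^-1 *: y)) \o vec_of_tuple).
      exact: (borel_shift 0 2^-1 (tame_borel bf)).
    by apply/funext => s /=; rewrite add0r.
have i2 : 0 < 2^-1 :> R by rewrite invr_gt0.
rewrite ge0_integralD//; last 2 first.
- by move=> s _; rewrite lee_fin f0.
- apply/measurable_EFinP.
  rewrite (_ : (fun _ => _) = (fun y => f (0 + 2^-1 *: y)) \o vec_of_tuple).
    exact: (borel_shift 0 2^-1 (tame_borel bf)).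
  by apply/funext => s /=; rewrite add0r.
rewrite (intRn_dilate i2 bf f0) exprVn invrK mulrDr EFinD.
by apply: leeD => //.
Qed.

End Dyadic.

(** * Reading the hypotheses and the norms *)

Section Norms.
Context {R : realType} {n : nat}.
Local Notation Rb := (measurableTypeR R).
Local Notation leb := (@lebesgue_Rn R n).
Implicit Types (x y : 'rV[R]_n) (f F u : 'rV[R]_n -> R).

Lemma L1_normE (A : set 'rV[R]_n) f : L1_norm A f =
  (\int[leb]_t (\1_A (vec_of_tuple t) * `|f (vec_of_tuple t)|)%:E)%E.
Proof.
rewrite /L1_norm integral_mkcond; apply: eq_integral => t _.
rewrite /patch indicE; have [At|At] := pselect (A (vec_of_tuple t)).
  by rewrite !mem_set// mul1r.
by rewrite !memNset// mul0r.
Qed.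

Lemma L1_norm_center u (A : set 'rV[R]_n) (t : R) : smooth_closed_ball u ->
  tame (\1_A : 'rV[R]_n -> R) -> A `<=` eball 1 ->
  L1_norm A (fun x => u x - t) = (L1_dist u A t)%:E.
Proof.
move=> su bA AB; rewrite L1_normE /L1_dist EFin_intRn; last exact: tame_L1_dist.
apply: eq_integral => s _; congr EFin.
rewrite indicE; have [As|As] := pselect (A (vec_of_tuple s)).
  by rewrite on_ballE//; exact: AB.
by rewrite memNset// !mul0r.
Qed.

Lemma L1_norm_grad u : smooth_closed_ball u ->
  L1_norm (eball 1) (fun x => enorm (grad u x)) = (intRn (gradnorm u))%:E.
Proof.
move=> su; rewrite L1_normE EFin_intRn; last exact: tame_gradnorm.
apply: eq_integral => s _; congr EFin.
rewrite indicE; have [Bs|Bs] := pselect (eball 1 (vec_of_tuple s)).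
  by rewrite mem_set// mul1r /gradnorm on_ballE// ger0_norm// enorm_ge0.
by rewrite memNset// mul0r /gradnorm on_ball_out.
Qed.

Lemma intRn_radial_slope_le u : smooth_closed_ball u ->
  ((intRn (radial_slope u))%:E <= L1_norm annulus (radial_derivative u))%E.
Proof.
move=> su; rewrite L1_normE EFin_intRn; last exact: tame_radial_slope.
pose O : set 'rV[R]_n := enorm @^-1` [set y | 0 < y].
have oO : open O.
  by apply: open_comp => [x _|]; [exact: enorm_continuous|exact: open_gt].
have mi : borel ((fun x => (enorm x)^-1) \_ O).
  apply: borel_continuous_on => // x; rewrite /O /= => x0.
  by apply: cvgV; [exact: nbhs_filter x|exact: lt0r_neq0|exact: enorm_continuous].
have E y : \1_annulus y * `|radial_derivative u y| =
    ((fun x => (enorm x)^-1) \_ O) y * radial_slope u y.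
  rewrite /radial_slope !indicE; have [Ay|Ay] := pselect (annulus y); last first.
    by rewrite memNset// !mul0r mulr0.
  have y0 : 0 < enorm y.
    by case: Ay => _ /negP; rewrite /eball /= -leNgt; lra.
  rewrite mem_set// !mul1r patchT; last by rewrite inE.
  rewrite -{1}[(enorm y)^-1]ger0_norm; last by rewrite invr_ge0 ltW.
  rewrite -normrM mulr_sumr; congr (`|_|); apply: eq_bigr => i _.
  by rewrite on_ballE; [ring|case: Ay].
apply: ge0_le_integral => //.
- by move=> t _; rewrite lee_fin radial_slope_ge0.
- by apply/measurable_EFinP; exact: (tame_borel (tame_radial_slope su)).
- apply/measurable_EFinP.
  rewrite (_ : (fun _ => _) =
     (fun y => ((fun x => (enorm x)^-1) \_ O) y * radial_slope u y) \o vec_of_tuple).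
    by apply: borelM => //; exact: (tame_borel (tame_radial_slope su)).
  by apply/funext => t /=; rewrite E.
move=> t _; rewrite lee_fin E; set y := vec_of_tuple t.
have [Ay|Ay] := pselect (annulus y); last first.
  by rewrite /radial_slope indicE memNset// !mul0r mulr0.
have y0 : 0 < enorm y by case: Ay => _ /negP; rewrite /eball /= -leNgt; lra.
rewrite patchT; last by rewrite inE.
apply: ler_peMl; first exact: radial_slope_ge0.
rewrite -[leLHS]invr1 lef_pV2 ?posrE//.
by case: Ay => By _; exact: ltW.
Qed.

(** In the open ball the continuous extensions used in the statement are the
functions themselves. *)
Lemma within_eball (x : 'rV[R]_n) : eball 1 x ->
  within (eball 1) (nbhs x) = nbhs x.
Proof.
move=> Bx; apply/seteqP; split => P.
  rewrite /within /= => H; apply: filterS2 H (nbhs_eball Bx) => y Py; exact: Py.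
by move=> H; rewrite /within /=; apply: filterS H => y.
Qed.

Lemma closure_extE F x : eball 1 x -> {for x, continuous F} ->
  closure_ext F x = F x.
Proof. by move=> Bx cF; rewrite /closure_ext within_eball//; exact: cvg_lim. Qed.

Lemma C0_norm_ge F x : eclosed_ball 1 x -> (`|F x|%:E <= C0_norm F)%E.
Proof. by move=> Bx; apply: ereal_sup_ubound; exists x. Qed.

Lemma eclosed_ball0 : @eclosed_ball R n 1 0.
Proof. by rewrite /eclosed_ball /= enorm0 ler01. Qed.

Lemma term_le_sum (I : finType) (F : I -> R) i : (forall i, 0 <= F i) ->
  F i <= \sum_i F i.
Proof. by move=> F0; rewrite (bigD1 i)//= lerDl sumr_ge0. Qed.

Lemma coefficient_bounds (A : 'rV[R]_n -> 'M[R]_n) (b : 'rV[R]_n -> 'rV[R]_n) (eps : R) :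
  (forall i j, smooth_closed_ball (fun x => A x i j)) ->
  (C0_norm (deriv_mx_norm A) + C0_norm (fun x => enorm (b x)) <= eps%:E)%E ->
  (forall x i j k, eball 1 x -> `|partial k (fun y => A y i j) x| <= eps) /\
  (forall x i, eball 1 x -> `|b x 0 i| <= eps).
Proof.
move=> sA Ceps.
have cA : (0 <= C0_norm (deriv_mx_norm A))%E.
  by apply: le_trans (C0_norm_ge _ eclosed_ball0); rewrite lee_fin.
have cb : (0 <= C0_norm (fun x => enorm (b x)))%E.
  by apply: le_trans (C0_norm_ge _ eclosed_ball0); rewrite lee_fin.
split=> [x i j k Bx|x i Bx]; have Bx' : eclosed_ball 1 x by exact: ltW.
  rewrite -lee_fin; apply: le_trans Ceps; apply: (le_trans _ (leeDl _ cb)).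
  apply: (le_trans _ (C0_norm_ge _ Bx')); rewrite lee_fin.
  rewrite [leRHS]ger0_norm ?sqrtr_ge0// /deriv_mx_norm -sqrtr_sqr; apply: ler_wsqrtr.
  have -> : partial k (fun y => A y i j) x = closure_ext (partial k (fun y => A y i j)) x.
    rewrite closure_extE//; apply: differentiable_continuous.
    exact: (smooth_differentiable [:: k] (sA i j)).
  pose g i j k := closure_ext (partial k (fun y => A y i j)) x ^+ 2.
  have g0 i' j' k' : 0 <= g i' j' k' by exact: sqr_ge0.
  apply: (le_trans (term_le_sum k (g0 i j))).
  apply: (le_trans (term_le_sum j (F := fun j => \sum_k g i j k) _)) => [j'|].
    by apply: sumr_ge0 => k' _.
  apply: (term_le_sum i (F := fun i => \sum_j \sum_k g i j k)) => i'.
  by apply: sumr_ge0 => j' _; apply: sumr_ge0 => k' _.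
rewrite -lee_fin; apply: le_trans Ceps; apply: (le_trans _ (leeDr _ cA)).
apply: (le_trans _ (C0_norm_ge _ Bx')); rewrite lee_fin.
by rewrite (ger0_norm (enorm_ge0 _)); exact: coord_le_enorm.
Qed.

Lemma increment_bound F (eps : R) x : smooth_closed_ball F ->
  (forall y k, eball 1 y -> `|partial k F y| <= eps) -> eball 1 x ->
  `|F x - F 0| <= n%:R * eps.
Proof.
move=> sF Feps Bx.
have sB (s : R) : 0 <= s <= 1 -> eball 1 (0 + s *: x).
  move=> /andP[s0 s1]; rewrite add0r /eball /= enormZ ger0_norm//.
  by move: Bx; rewrite /eball /=; have := enorm_ge0 x; nra.
pose g s := \sum_k x 0 k * partial k F (0 + s *: x).
have dg (s : R) : 0 <= s <= 1 -> is_derive s 1 (fun s => F (0 + s *: x)) (g s).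
  move=> s01; apply: is_derive_line; apply: is_derive_partial.
  exact: (smooth_differentiable [::] sF (sB s s01)).
have [||s] := @MVT_segment R (fun s => F (0 + s *: x)) g 0 1 ler01.
- by move=> s; rewrite in_itv/= => /andP[s0 s1]; apply: dg; rewrite !ltW.
- apply/subspace_continuousP => s /=; rewrite in_itv /= => s01.
  apply: cvg_within_filter; apply: differentiable_continuous.
  by apply/derivable1_diffP; have := dg s s01 => H; exact: ex_derive.
rewrite in_itv/= => s01; rewrite scale1r scale0r !add0r subr0 mulr1 => ->.
rewrite /g mulr_natl -[X in _ *+ X](card_ord n) -sumr_const.
apply: le_trans (ler_norm_sum _ _ _) _; apply: ler_sum => k _.
rewrite normrM -[leRHS]mul1r; apply: ler_pM => //; last exact: Feps (sB s s01).
by apply: le_trans (coord_le_enorm x k) (ltW Bx).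
Qed.

Lemma L1_dist_annulus u (t : R) : smooth_closed_ball u ->
  L1_dist u annulus t <= L1_dist u (dyadic (1 / 8)) t + L1_dist u (dyadic (2 * (1 / 8))) t +
    L1_dist u (dyadic (2 * (2 * (1 / 8)))) t.
Proof.
move=> su; have b r := tame_L1_dist su t (@tame_indic_dyadic R n r).
rewrite /L1_dist -intRnD// -intRnD//; last exact: tameD.
apply: le_intRn => [||x]; first by apply: tame_L1_dist => //; exact: tame_indic_annulus.
  by apply: tameD => //; exact: tameD.
rewrite -!mulrDl; apply: ler_wpM2r => //; rewrite !indicE.
have [Ax|Ax] := pselect (annulus x); last by rewrite memNset// !addr_ge0.
rewrite mem_set//; move: Ax => [Bx /negP]; rewrite /eball /= -leNgt => Ax.
have [x1|x1] := ltP (enorm x) (2 * (1 / 8)).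
  have -> : x \in dyadic (1 / 8).
    by rewrite inE; split => //; apply/negP; rewrite -leNgt.
  by rewrite -addrA lerDl addr_ge0.
have [x2|x2] := ltP (enorm x) (2 * (2 * (1 / 8))).
  have -> : x \in dyadic (2 * (1 / 8)).
    by rewrite inE; split => //; apply/negP; rewrite -leNgt.
  by rewrite addrAC lerDr addr_ge0.
have -> : x \in dyadic (2 * (2 * (1 / 8))).
  rewrite inE; split; last by apply/negP; rewrite -leNgt.
  by apply: lt_le_trans Bx _; lra.
by rewrite lerDr addr_ge0.
Qed.

End Norms.

(** * Conclusion *)

Section AnnulusBound.
Context {R : realType} {n : nat}.
Implicit Types (m d : R) (u H : 'rV[R]_n -> R).

Definition inner_const m : R := (@mollifier_mass R n)^-1 *
  (intRn (fun z : 'rV[R]_n => 8 * \1_(@eclosed_ball R n (5 / 8)) z) * m +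
   intRn (\1_(@eclosed_ball R n (1 / 4)) : 'rV[R]_n -> R) * (1056 + 2000 * m)).

(** The three terms bound the contributions of the rings with inner radii [1/8],
[1/4] and [1/2]. *)
Definition annulus_const m : R :=
  inner_const m + 2 ^+ n * (inner_const m + 1) +
  2 ^+ n * (2 ^+ n * (inner_const m + 1) + 1).

Lemma annulus_const_ge0 m : (0 < n)%N -> 0 <= m -> 0 <= annulus_const m.
Proof.
move=> n0 m0; have N0 : 0 <= 2 ^+ n :> R by rewrite exprn_ge0.
have P0 : 0 <= inner_const m.
  apply: mulr_ge0; first by rewrite invr_ge0 ltW ?mollifier_mass_gt0.
  have w0 : 0 <= 1056 + 2000 * m by lra.
  apply: addr_ge0 (mulr_ge0 _ m0) (mulr_ge0 _ w0).
    by apply: intRn_ge0 => z; rewrite mulr_ge0// indicE.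
  by apply: intRn_ge0 => z; rewrite indicE.
have NP := mulr_ge0 N0 (addr_ge0 P0 ler01).
exact: addr_ge0 (addr_ge0 P0 NP) (mulr_ge0 N0 (addr_ge0 NP ler01)).
Qed.

Lemma annulus_bound u H m d : (0 < n)%N -> smooth_closed_ball u -> tame H ->
  (forall y, 0 <= H y) ->
  (forall S K zeta dzeta x (s : R), testfun S K zeta dzeta ->
    0 <= s <= 1 -> (forall z, S z -> eball 1 (x + s *: z)) ->
    `|intRn (fun z => \sum_i dzeta i z * on_ball (partial i u) (x + s *: z))| <=
    K * intRn (fun z => \1_S z * H (x + s *: z))) ->
  intRn (fun y => \1_(@eclosed_ball R n (7 / 8)) y * H y) <= m * d ->
  intRn (radial_slope u) <= d ->
  L1_dist u annulus (center u) <= annulus_const m * d.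
Proof.
move=> n0 su bH H0 dual mass rd; set t := center u.
set P := inner_const m; pose N : R := 2 ^+ n.
have N0 : 0 <= N by rewrite exprn_ge0.
have X1 : L1_dist u (dyadic (1 / 8)) t <= P * d.
  have b14 : tame (\1_(@eclosed_ball R n (1 / 4)) : 'rV[R]_n -> R).
    apply: (tame_indic (r := 1)).
      by apply: measurable_closed; exact: closed_eclosed_ball.
    by move=> z Bz /=; apply: le_lt_trans (norm_le_enorm z) (le_lt_trans Bz _); lra.
  have bo := tame_L1_dist su t b14.
  have := near_bound su bH H0 dual mass n0; rewrite -/t -(EFin_intRn bo) lee_fin => E1.
  apply: (@le_trans _ _ (intRn (fun y => \1_(eclosed_ball (1 / 4)) y * `|on_ball u y - t|))).
    apply: le_intRn => //; first by apply: tame_L1_dist => //; exact: tame_indic_dyadic.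
    move=> y; apply: ler_wpM2r => //; rewrite !indicE.
    have [Dy|Dy] := pselect (dyadic (1 / 8) y); last by rewrite memNset.
    rewrite !mem_set//; move: Dy => [Dy _]; rewrite /eclosed_ball /=.
    by apply: ltW; apply: lt_le_trans Dy _; lra.
  apply: le_trans E1 _; rewrite /P /inner_const -[leRHS]mulrA.
  apply: ler_wpM2l; first by rewrite invr_ge0 ltW ?mollifier_mass_gt0.
  rewrite [leRHS]mulrDl; apply: lerD; first by rewrite mulrA.
  rewrite -[leRHS]mulrA; apply: ler_wpM2l; first by apply: intRn_ge0 => z; rewrite indicE.
  by rewrite [leRHS]mulrDl -[2000 * m * d]mulrA; lra.
have X2 : L1_dist u (dyadic (2 * (1 / 8))) t <= N * (P + 1) * d.
  apply: le_trans (dyadic_step su t _ _) _; [by lra|by lra|].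
  by rewrite -[leRHS]mulrA; apply: ler_wpM2l => //; rewrite [leRHS]mulrDl [1 * d]mul1r lerD.
have X3 : L1_dist u (dyadic (2 * (2 * (1 / 8)))) t <= N * (N * (P + 1) + 1) * d.
  apply: le_trans (dyadic_step su t _ _) _; [by lra|by lra|].
  by rewrite -[leRHS]mulrA; apply: ler_wpM2l => //; rewrite [leRHS]mulrDl [1 * d]mul1r lerD.
apply: le_trans (L1_dist_annulus t su) _.
rewrite /annulus_const -/P -/N [leRHS]mulrDl; apply: lerD X3.
by rewrite [leRHS]mulrDl; exact: lerD.
Qed.

End AnnulusBound.

Theorem proposition1p5 (R : realType) (n : nat) (lambda : R) :
  (0 < n)%N -> 0 < lambda ->
  exists2 C : R, 0 < C &
    forall (Lambda eps : R) (A : 'rV[R]_n -> 'M[R]_n)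
      (b : 'rV[R]_n -> 'rV[R]_n) (u : 'rV[R]_n -> R),
    (forall i j, smooth_closed_ball (fun x => A x i j)) ->
    (forall i, smooth_closed_ball (fun x => b x 0 i)) ->
    (forall x, eclosed_ball 1 x -> forall i j, A x i j = A x j i) ->
    (forall x p, eball 1 x -> enorm p = 1 ->
      lambda <= \sum_i \sum_j A x i j * p 0 i * p 0 j <= Lambda) ->
    smooth_closed_ball u ->
    (forall x, eball 1 x -> operator A b u x <= 0) ->
    A 0 = 1%:M ->
    0 < eps ->
    (C0_norm (deriv_mx_norm A) + C0_norm (fun x => enorm (b x)) <= eps%:E)%E ->
    exists t : R,
      (L1_norm (eball 1 `\` eball (1 / 8)) (fun x => (u x - t)%R)
       <= C%:E * L1_norm (eball 1 `\` eball (1 / 8)) (radial_derivative u)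
          + C%:E * eps%:E * L1_norm (eball 1) (fun x => enorm (grad u x)))%E.
Proof.
move=> n0 _; pose m := @mass_const R n; have m0 : 0 <= m := mass_const_ge0.
have K0 : 0 <= @annulus_const R n m := annulus_const_ge0 n0 m0.
exists (@annulus_const R n m + 1); first by apply: ltr_wpDl.
move=> Lambda eps A b u sA sb _ _ su Lu A0 /ltW eps0 Ceps.
have [A_D b_le] := coefficient_bounds sA Ceps.
have A_I x i j : eball 1 x -> `|A x i j - (i == j)%:R| <= n%:R * eps.
  move=> Bx; have := increment_bound (sA i j) (fun y k => @A_D y i j k) Bx.
  by rewrite A0 mxE.
have rd : intRn (radial_slope u) <= smallness u eps.
  by rewrite /smallness lerDl mulr_ge0// intRn_ge0//; exact: gradnorm_ge0.
have d0 : 0 <= smallness u eps by exact: smallness_ge0.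
have bound := annulus_bound n0 su (tame_source eps sA sb su) (source_ge0 eps0 Lu)
  (dual_bound sA sb su eps0 Lu A_I A_D b_le)
  (mass_bound sA sb su eps0 Lu A_I A_D b_le) rd.
exists (center u).
rewrite (L1_norm_center _ su); [|exact: tame_indic_annulus|by move=> x []].
rewrite (L1_norm_grad su); set C := annulus_const m + 1.
have C0 : 0 <= C by rewrite addr_ge0.
apply: (@le_trans _ _ (C * smallness u eps)%:E).
  by rewrite lee_fin mulrDl; apply: le_trans bound _; rewrite lerDl mul1r.
rewrite /smallness mulrDr EFinD; apply: leeD.
  by rewrite EFinM; apply: lee_wpmul2l; [rewrite lee_fin|exact: intRn_radial_slope_le].
by rewrite -!EFinM mulrA.
Qed.
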